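(* Let $P\subset\mathbb{R}^d$ ($d\ge2$) be a spanning $d$-dimensional polytope, let $f$ be a contracting reflection law, and let $\mu$ be an ergodic $\Phi_{f,P}$-invariant Borel probability measure supported on $D$. If the escaping time $T$ is $\mu$-integrable, then $\mu$ is hyperbolic.
   Context: **Polytopes.** A polytope is a compact finite intersection of closed half-spaces of $\mathbb{R}^d$. Let $P$ be a $d$-dimensional polytope with $(d-1)$-dimensional faces $F_1,\dots,F_N$ (called faces), relative interiors $F_i^\circ$, inward unit normals $\eta_i$, and skeleton $\Sigma P=\bigcup_i\partial F_i$. For $\varepsilon>0$, $P$ is $\varepsilon$-spanning if for any $d$ distinct faces $F_{i_1},\dots,F_{i_d}$ the angle between $\eta_{i_1}$ and the linear span of $\eta_{i_2},\dots,\eta_{i_d}$ is at least $\varepsilon$ (the angle between a nonzero vector and a subspace is the minimum of the angles with nonzero vectors of the subspace). $P$ is spanning if it is $\varepsilon$-spanning for some $\varepsilon>0$. **Notation.** $\mathbb{S}$ is the unit sphere of $\mathbb{R}^d$; $\mathbb{S}^+_\eta=\{v\in\mathbb{S}:\langle v,\eta\rangle>0\}$; $P_\eta(v)=\langle v,\eta\rangle\eta$; $P_{\eta^\perp}(v)=v-\langle v,\eta\rangle\eta$; $R_\eta(v)=v-2\langle v,\eta\rangle\eta$. **Contracting laws.** A contracting law is a family of $C^2$ maps $C_\eta:\mathbb{S}^+_\eta\to\mathbb{S}^+_\eta$, $\eta\in\mathbb{S}$, with: $C_\eta(\eta)=\eta$; $C_\eta(v)=a_\eta(v)P_\eta(v)+b_\eta(v)P_{\eta^\perp}(v)$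 for non-negative $C^2$ functions $a_\eta,b_\eta$; $0<\sup_{v}\|DC_\eta(v)\|<1$; $O\circ C_\eta=C_{O\eta}\circ O$ for every orthogonal $O$. It is determined by a $C^2$ function $f:[0,\pi/2)\to[0,\pi/2)$ with $f(0)=0$ and $0<\lambda(f):=\sup|f'|<1$, through $C_\eta(v)=\frac{\cos f(\theta)}{\cos\theta}P_\eta(v)+\frac{\sin f(\theta)}{\sin\theta}P_{\eta^\perp}(v)$, $\theta=\arccos\langle v,\eta\rangle$. Such an $f$ is called a contracting reflection law. **Billiard map.** $M=\bigcup_i F_i^\circ\times\mathbb{S}^+_{\eta_i}$; $M'$ is the set of $(p,v)\in M$ such that the half-line $\{p+tv:t\ge0\}$ does not meet $\Sigma P$. For $(p,v)\in M'$ let $\tau>0$ be the least $t>0$ with $p+tv\in F_j^\circ$ for some $j$; then $\Phi_{f,P}(p,v)=(p+\tau v,\,C_{\eta_j}(R_{\eta_j}(v)))$. Write $\Phi=\Phi_{f,P}$. $M^+=\{x\in M:\Phi^n(x)\in M'\ \forall n\ge0\}$ and $D=\bigcap_{n\ge0}\Phi^n(M^+)$. Standing convention: $\Phi$ restricted to $D$ is regarded as an invertible map of $D$, with invertible derivative. **Escaping time.** For $x\in M^+$ let $\eta_{(n)}$ be the inward normal of the face containing the base point of $\Phi^n(x)$. For $k\in\mathbb{N}$, $x$ is $k$-generating if for every $n\ge0$ the normals $\eta_{(n)},\dots,\eta_{(n+k-1)}$ along the orbit segment of $k$ consecutive collisions span $\mathbb{R}^d$. $T(x)\in\mathbb{N}\cup\{\infty\}$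 is the least $k$ such that $x$ is $k$-generating ($T(x)=\infty$ if there is none). **Hyperbolic measure.** For $x\in D$ and nonzero $w\in T_xM$ let $\chi(x,w)=\limsup_{n\to\infty}\frac1n\log\|D\Phi^n(x)w\|$. A $\Phi$-invariant Borel probability measure $\mu$ supported on $D$ is hyperbolic if for $\mu$-almost every $x\in D$ one has $\chi(x,w)\ne0$ for every nonzero $w\in T_xM$. *)

(* Defs.v *)
From HB Require Import structures.
From mathcomp Require Import all_boot all_order all_algebra.
From mathcomp Require Import all_classical all_reals all_analysis.

Set Implicit Arguments.
Unset Strict Implicit.
Unset Printing Implicit Defensive.

Import Order.TTheory GRing.Theory Num.Theory.
Import numFieldNormedType.Exports.

Local Open Scope classical_set_scope.
Local Open Scope ring_scope.

Section Euclidean.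
Context {R : realType} {d : nat}.
Implicit Types (u v eta : 'rV[R]_d) (A : set 'rV[R]_d).

(* The library norm on 'rV[R]_d is the sup norm; it is used below only through
   its topology, and lengths and angles come from [dot]. *)
Definition dot u v : R := \sum_(i < d) u 0 i * v 0 i.

Definition enorm u : R := Num.sqrt (dot u u).

Definition sphere : set 'rV[R]_d := [set v | enorm v = 1].

Definition half_sphere eta : set 'rV[R]_d := sphere `&` [set v | 0 < dot v eta].

Definition proj eta v : 'rV[R]_d := dot v eta *: eta.
Definition proj_orth eta v : 'rV[R]_d := v - dot v eta *: eta.
Definition reflection eta v : 'rV[R]_d := v - (2 * dot v eta) *: eta.

Definition angle u v : R := acos (dot u v / (enorm u * enorm v)).

(* Angle between [v] and the row space of [B], which has to be nonzero: the
   angles are bounded below by 0 and their infimum is attained. *)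
Definition angle_span m v (B : 'M[R]_(m, d)) : R :=
  inf [set angle v w | w in [set w : 'rV[R]_d | (w <= B)%MS /\ w != 0]].

Definition affine_hull A : set 'rV[R]_d :=
  [set y | exists n (a : 'I_n -> R) (x : 'I_n -> 'rV[R]_d),
     [/\ forall i, A (x i), \sum_i a i = 1 & y = \sum_i a i *: x i]].

Definition has_dim A (k : nat) : Prop :=
  exists (x0 : 'rV[R]_d) (B : 'M[R]_(k, d)),
    row_free B /\ affine_hull A = [set y | (y - x0 <= B)%MS].

Definition relint A : set 'rV[R]_d :=
  A `&` [set x | \forall y \near within (affine_hull A) (nbhs x), A y].

Definition relbd A : set 'rV[R]_d := closure A `\` relint A.

End Euclidean.

Section Polytope.
Context {R : realType} {d : nat}.
Implicit Types (P : set 'rV[R]_d) (eta : 'rV[R]_d).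

Definition is_polytope P : Prop :=
  compact P /\
  exists (N : nat) (a : 'I_N -> 'rV[R]_d) (c : 'I_N -> R),
    (forall i, a i != 0) /\ P = [set x | forall i, c i <= dot (a i) x].

(* Intersection of [P] with its supporting hyperplane of inward normal [eta]. *)
Definition face P eta : set 'rV[R]_d :=
  [set x | P x /\ forall y, P y -> dot eta x <= dot eta y].

(* The faces F_1, ..., F_N of a d-dimensional polytope are indexed by their
   inward unit normals: such an [F_i] is [face P eta] for exactly one [eta]
   with [facet_normal P eta]. *)
Definition facet_normal P : set 'rV[R]_d :=
  [set eta | sphere eta /\ has_dim (face P eta) d.-1].

Definition skeleton P : set 'rV[R]_d :=
  \bigcup_(eta in facet_normal P) relbd (face P eta).

(* Since every ordering of the [d] faces is allowed, any [i] may play the role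
   of the first index; the rows of [row' i _] are the remaining normals. *)
Definition eps_spanning P (eps : R) : Prop :=
  forall eta : 'I_d -> 'rV[R]_d,
    (forall i, facet_normal P (eta i)) ->
    injective (fun i => face P (eta i)) ->
    forall i, eps <= angle_span (eta i) (row' i (\matrix_(j < d) eta j)).

Definition spanning P : Prop := exists eps, 0 < eps /\ eps_spanning P eps.

End Polytope.

Section ContractingLaw.
Context {R : realType}.
Implicit Types f : R -> R.

Definition dom_law : set R := `[0, pi / 2[%classic.

(* [df] is the derivative of [f] on [A], one-sided at endpoints of [A]. *)
Definition is_derive_on (A : set R) (f df : R -> R) : Prop :=
  forall x, A x ->
    (f y - f x) / (y - x) @[y --> within (A `\ x) (nbhs x)] --> df x.

(* Only the restriction of [f] to [0, pi/2) is constrained. *)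
Definition contracting_law f : Prop :=
  [/\ forall t, dom_law t -> dom_law (f t),
      f 0 = 0 &
      exists f1 f2 : R -> R,
        [/\ is_derive_on dom_law f f1,
            is_derive_on dom_law f1 f2,
            {within dom_law, continuous f2} &
            (0 < ereal_sup [set `|f1 t|%:E | t in dom_law] < 1)%E]].

(* At [v = eta] the second coefficient is a division by zero, but it multiplies
   [proj_orth eta eta = 0]; so [law_map f eta eta = eta]. *)
Definition law_map f {d : nat} (eta v : 'rV[R]_d) : 'rV[R]_d :=
  let t := acos (dot v eta) in
  (cos (f t) / cos t) *: proj eta v + (sin (f t) / sin t) *: proj_orth eta v.

End ContractingLaw.

Notation phase R d := ('rV[R]_d * 'rV[R]_d)%type.

Notation borel_phase R d := (g_sigma_algebraType (@open (phase R d))).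

Section Billiard.
Context {R : realType} {d : nat}.
Variables (f : R -> R) (P : set 'rV[R]_d).
Implicit Types (x w : phase R d) (p v eta : 'rV[R]_d).

(* [eta] is the normal of the face whose relative interior contains [p]. *)
Definition normal_of p : set 'rV[R]_d :=
  [set eta | facet_normal P eta /\ relint (face P eta) p].

Definition normal_at p : 'rV[R]_d := xget 0 (normal_of p).

Definition M : set (phase R d) :=
  [set x | exists2 eta, normal_of x.1 eta & half_sphere eta x.2].

Definition M' : set (phase R d) :=
  M `&` [set x | forall t, 0 <= t -> ~ skeleton P (x.1 + t *: x.2)].

(* On [M'] the infimum is a minimum. *)
Definition hit_time x : R :=
  inf [set t | 0 < t /\ exists eta, normal_of (x.1 + t *: x.2) eta].

(* Meaningful on [M'] only. *)
Definition Phi x : phase R d :=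
  let q := x.1 + hit_time x *: x.2 in
  let eta := normal_at q in
  (q, law_map f eta (reflection eta x.2)).

Definition Mplus : set (phase R d) :=
  M `&` [set x | forall n, M' (iter n Phi x)].

Definition D : set (phase R d) := \bigcap_n (iter n Phi @` Mplus).

Definition tangent x : set (phase R d) :=
  [set w | dot w.1 (normal_at x.1) = 0 /\ dot w.2 x.2 = 0].

(* For [x] in [M] and [w] tangent at [x], this curve lies in [M] for small [s],
   passes through [x] at [s = 0] and has velocity [w] there. *)
Definition curve x w (s : R) : phase R d :=
  (x.1 + s *: w.1, (enorm (x.2 + s *: w.2))^-1 *: (x.2 + s *: w.2)).

(* The differential of the n-th iterate as a map of the manifold [M]. *)
Definition DPhi (n : nat) x w : phase R d :=
  derive1 (fun s => iter n Phi (curve x w s)) 0.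

Definition tnorm w : R := Num.sqrt (dot w.1 w.1 + dot w.2 w.2).

Definition generating (k : nat) x : Prop :=
  forall n, row_full (\matrix_(j < k) normal_at (iter (n + j) Phi x).1).

Definition escaping_time x : \bar R :=
  ereal_inf [set k%:R%:E | k in [set k | generating k x]].

(* [lne] is the extended logarithm, with [lne 0 = -oo]. *)
Definition lyapunov x w : \bar R :=
  limn_esup (fun n => (n%:R^-1)%:E * lne (tnorm (DPhi n x w))%:E)%E.

Definition invertible_on_D : Prop :=
  set_bij D D Phi /\
  forall x, D x -> set_bij (tangent x) (tangent (Phi x)) (DPhi 1 x).

Implicit Type mu : probability (borel_phase R d) R.

Definition supported_on_D mu : Prop := mu.-negligible (~` D).

(* [Phi] has domain [M'], hence the intersection. *)
Definition Phi_invariant mu : Prop :=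
  forall A : set (borel_phase R d), measurable A ->
    mu (M' `&` Phi @^-1` A) = mu A.

(* To be used for measures supported on [D], where [Phi] is a self-map of [D]. *)
Definition Phi_ergodic mu : Prop :=
  forall A : set (borel_phase R d), measurable A ->
    D `&` Phi @^-1` A = D `&` A -> mu A = 0%E \/ mu A = 1%E.

Definition hyperbolic mu : Prop :=
  {ae mu, forall x, D x ->
     forall w, tangent x w -> w != 0 -> lyapunov x w != 0%E}.

End Billiard.

(* Main.v *)
(* The argument is pointwise: it only uses that, for almost every x, there is a
   finite k such that any k consecutive normals along the orbit of x span the
   space. Let (u_n, w_n) be the image of a tangent vector under the n-th
   derivative, and v_n the velocity. A collision contracts velocities by a
   factor kap < 1 for the chordal metric, so |w_n| <= kap^n |w_0|. The length
   a_n of the projection of u_n orthogonally to v_n changes by O(kap^n) during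
   the free flight. At the collision u_{n+1} is orthogonal to the normal, along
   which v_{n+1} is v_n with its tangential part shrunk by a factor r <= kap;
   hence a_{n+1}^2 is at least the squared length after the flight plus
   (1 - kap^2) <u_{n+1}, v_n>^2. If a_n is large compared with kap^n and does
   not grow by a definite factor over a block of k + 1 collisions, all these
   scalar products are small, so u is almost constant along the block while
   being orthogonal to k spanning normals, which is impossible. Hence either
   a_n grows exponentially or |u_n| = O(kap^n), and the Lyapunov exponent is
   positive or negative accordingly. *)

(* The differential of an iterate is defined as the derivative of a curve, with a default value when
   that derivative does not exist. Hence curves, not points, are propagated: finite collision
   sequences are locally constant, and differentiability is proved collision by collision. The
   delicate case is a reflected velocity equal to the normal, where the angle to the normal is not
   differentiable.

   The derivative of the collision time has no a priori bound at grazing incidence. It only adds a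
   multiple of the velocity, so it disappears from the projection orthogonal to the velocity; this
   is why that projection is the quantity whose growth is followed.

   There are finitely many normals, so one constant measures the spanning of all blocks of a given
   length, wherever they sit in the orbit. Integrability enters through almost everywhere finiteness
   of the escaping time, which is extracted on a measurable domain; the map being only piecewise
   continuous, measurability takes a separate argument. *)
From HB Require Import structures.
Require Import Defs.
From mathcomp Require Import all_boot all_order all_algebra.
From mathcomp Require Import all_classical all_reals all_analysis.
From mathcomp Require Import ring lra.
Import numFieldNormedType.Exports.

Set Implicit Arguments.
Unset Strict Implicit.
Unset Printing Implicit Defensive.

Import Order.TTheory GRing.Theory Num.Theory.
Local Open Scope classical_set_scope.
Local Open Scope ring_scope.

(* Unification unfolds [nbhs] at row vectors, which hides it from the hint of
   the library. *)
#[local] Hint Extern 5 (Filter _) => solve [exact: nbhs_filter]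
  : typeclass_instances.

(** * Euclidean structure *)

Section Dot.
Context {R : realType} {d : nat}.
Implicit Types (u v w : 'rV[R]_d) (a : R).

Lemma dotC u v : dot u v = dot v u.
Proof. by apply: eq_bigr => i _; rewrite mulrC. Qed.

Lemma dotDl u v w : dot (u + v) w = dot u w + dot v w.
Proof. by rewrite -big_split; apply: eq_bigr => i _; rewrite mxE mulrDl. Qed.

Lemma dotZl a u v : dot (a *: u) v = a * dot u v.
Proof. by rewrite mulr_sumr; apply: eq_bigr => i _; rewrite mxE mulrA. Qed.

Lemma dotNl u v : dot (- u) v = - dot u v.
Proof. by rewrite -scaleN1r dotZl mulN1r. Qed.

Lemma dotBl u v w : dot (u - v) w = dot u w - dot v w.
Proof. by rewrite dotDl dotNl. Qed.

Lemma dot0l u : dot 0 u = 0.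
Proof. by rewrite -(scale0r u) dotZl mul0r. Qed.

Lemma dotDr u v w : dot u (v + w) = dot u v + dot u w.
Proof. by rewrite dotC dotDl !(dotC u). Qed.

Lemma dotZr a u v : dot u (a *: v) = a * dot u v.
Proof. by rewrite dotC dotZl dotC. Qed.

Lemma dotNr u v : dot u (- v) = - dot u v.
Proof. by rewrite dotC dotNl dotC. Qed.

Lemma dotBr u v w : dot u (v - w) = dot u v - dot u w.
Proof. by rewrite dotDr dotNr. Qed.

Lemma dot0r u : dot u 0 = 0.
Proof. by rewrite dotC dot0l. Qed.

Definition dotE := (dotDl, dotBl, dotNl, dotZl, dot0l, dotDr, dotBr, dotNr,
  dotZr, dot0r).

Lemma dot_sumr u n (F : 'I_n -> 'rV[R]_d) :
  dot u (\sum_i F i) = \sum_i dot u (F i).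
Proof.
elim/big_rec2: _ => [|i y1 y2 _ <-]; first by rewrite dot0r.
by rewrite dotDr.
Qed.

Lemma dot_ge0 u : 0 <= dot u u.
Proof. by apply: sumr_ge0 => i _; rewrite -expr2 sqr_ge0. Qed.

Lemma dot_eq0 u : (dot u u == 0) = (u == 0).
Proof.
apply/idP/eqP => [|->]; last by rewrite dot0l.
rewrite psumr_eq0 => [/allP u0|i _]; last by rewrite -expr2 sqr_ge0.
apply/rowP => i; rewrite mxE; apply/eqP.
by have := u0 i; rewrite mem_index_enum mulf_eq0 orbb => /(_ isT).
Qed.

Lemma dot_gt0 u : (0 < dot u u) = (u != 0).
Proof. by rewrite lt_def dot_eq0 dot_ge0 andbT. Qed.

Lemma enorm_ge0 u : 0 <= enorm u.
Proof. exact: sqrtr_ge0. Qed.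

Lemma sqr_enorm u : enorm u ^+ 2 = dot u u.
Proof. by rewrite sqr_sqrtr// dot_ge0. Qed.

Lemma enorm_eq0 u : (enorm u == 0) = (u == 0).
Proof. by rewrite -(sqrf_eq0 (enorm u)) sqr_enorm dot_eq0. Qed.

Lemma enorm0 : enorm (0 : 'rV[R]_d) = 0.
Proof. by apply/eqP; rewrite enorm_eq0. Qed.

Lemma enormZ a u : enorm (a *: u) = `|a| * enorm u.
Proof. by rewrite /enorm !dotE mulrA -expr2 sqrtrM ?sqr_ge0// sqrtr_sqr. Qed.

Lemma enormN u : enorm (- u) = enorm u.
Proof. by rewrite -scaleN1r enormZ normrN1 mul1r. Qed.

Lemma dot_sqr_le u v : dot u v ^+ 2 <= dot u u * dot v v.
Proof.
have [->|v0] := eqVneq v 0; first by rewrite !dotE mulr0 expr2 mulr0.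
have vv : 0 < dot v v by rewrite dot_gt0.
have := dot_ge0 (dot v v *: u - dot u v *: v).
rewrite !dotE (dotC v u) => h.
rewrite -(ler_pM2l vv); lra.
Qed.

Lemma ler_dot_enorm u v : `|dot u v| <= enorm u * enorm v.
Proof.
rewrite -ler_sqr ?nnegrE ?mulr_ge0 ?enorm_ge0//.
by rewrite exprMn !sqr_enorm real_normK ?num_real// dot_sqr_le.
Qed.

Lemma ler_enormD u v : enorm (u + v) <= enorm u + enorm v.
Proof.
rewrite -ler_sqr ?nnegrE ?addr_ge0 ?enorm_ge0// sqrrD !sqr_enorm !dotE.
rewrite (dotC v u).
have := le_trans (ler_norm _) (ler_dot_enorm u v); lra.
Qed.

Lemma ler_enormB u v : enorm (u - v) <= enorm u + enorm v.
Proof. by rewrite -(enormN v) ler_enormD. Qed.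

Lemma ler_distB_enorm u v : enorm u - enorm v <= enorm (u - v).
Proof. by rewrite lerBlDr -{1}(subrK v u) ler_enormD. Qed.

Lemma ler_coord_enorm u i : `|u 0 i| <= enorm u.
Proof.
rewrite -ler_sqr ?nnegrE ?enorm_ge0// sqr_enorm real_normK ?num_real//.
rewrite /dot (bigD1 i)//= -expr2 lerDl sumr_ge0// => j _.
by rewrite -expr2 sqr_ge0.
Qed.

Lemma ler_norm_enorm u : `|u| <= enorm u.
Proof.
rewrite /Num.Def.normr /= mx_normrE; apply/bigmax_leP; split=> [|[i j] _] /=.
  exact: enorm_ge0.
by rewrite ord1 ler_coord_enorm.
Qed.

Lemma cvg_dot T (F : set_system T) {FF : Filter F} (g h : T -> 'rV[R]_d) u v :
  g @ F --> u -> h @ F --> v -> dot (g x) (h x) @[x --> F] --> dot u v.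
Proof.
move=> gu hv; apply: (@cvg_big R 'I_d +%R 0 xpredT (@add_continuous R)) => i _.
apply: cvgM.
  exact: (cvg_comp g _ gu (@coord_continuous R 1 d 0 i u)).
exact: (cvg_comp h _ hv (@coord_continuous R 1 d 0 i v)).
Qed.

Lemma cvg_enorm T (F : set_system T) {FF : Filter F} (g : T -> 'rV[R]_d) u :
  g @ F --> u -> enorm (g x) @[x --> F] --> enorm u.
Proof.
move=> gu; exact: (cvg_comp _ _ (cvg_dot gu gu) (@sqrt_continuous R _)).
Qed.

(** Estimates are Euclidean while the topology is that of the sup norm; it suffices that the
    Euclidean norm dominates. *)
Lemma cvg_enorm0 T (F : set_system T) {FF : Filter F} (g : T -> 'rV[R]_d) u :
  enorm (g x - u) @[x --> F] --> 0 -> g @ F --> u.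
Proof.
move=> h; apply/cvgrPdist_le => e e0.
move/cvgrPdist_le : h => /(_ _ e0); apply: filterS => x.
rewrite sub0r normrN ger0_norm ?enorm_ge0// distrC; apply: le_trans.
exact: ler_norm_enorm.
Qed.

Lemma is_derive_rowP (g : R -> 'rV[R]_d) (t : R) w :
  is_derive t 1 g w <->
  forall i, is_derive t 1 (fun s => g s 0 i) (w 0 i).
Proof.
split=> [[dg gw] i|h].
  have /derivable_mxP dgi := dg; split; first exact: dgi.
  by rewrite -gw derive_mx// mxE.
have dg : derivable g t 1.
  by apply/derivable_mxP => i j; rewrite ord1; case: (h j).
split=> //; rewrite derive_mx//; apply/rowP => i; rewrite mxE.
by case: (h i).
Qed.

Lemma is_derive_dot (g h : R -> 'rV[R]_d) (t : R) u v :
  is_derive t 1 g u -> is_derive t 1 h v ->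
  is_derive t 1 (fun s => dot (g s) (h s)) (dot (g t) v + dot u (h t)).
Proof.
move=> /is_derive_rowP gu /is_derive_rowP hv.
have -> : (fun s => dot (g s) (h s)) =
    \sum_(i < d) ((fun s => g s 0 i) * (fun s => h s 0 i)).
  by apply/funext => s; rewrite fct_sumE.
apply: is_derive_eq.
rewrite /dot -big_split; apply: eq_bigr => i _ /=.
by rewrite /GRing.scale /= (mulrC (h t 0 i)).
Qed.

Lemma is_derive_scale (a : R -> R) (g : R -> 'rV[R]_d) (t b : R) u :
  is_derive t 1 a b -> is_derive t 1 g u ->
  is_derive t 1 (fun s => a s *: g s) (a t *: u + b *: g t).
Proof.
move=> ab /is_derive_rowP gu; apply/is_derive_rowP => i.
have gui := gu i.
have -> : (fun s => (a s *: g s) 0 i) = a * (fun s => g s 0 i).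
  by apply/funext => s; rewrite mxE.
apply: is_derive_eq; rewrite !mxE /GRing.scale /=; congr (_ + _).
exact: mulrC.
Qed.

Lemma is_derive1_cvg (g : R -> 'rV[R]_d) (t : R) u :
  is_derive t 1 g u -> g s @[s --> t] --> g t.
Proof.
case=> dg _; exact: differentiable_continuous ((derivable1_diffP _ _).1 dg).
Qed.

End Dot.

(** * Irredundant half-space representations *)

Section HalfSpaces.
Context {R : realType} {d : nat}.
Implicit Types (P : set 'rV[R]_d) (x y z p e u v o : 'rV[R]_d).

(** For an irredundant representation this is the relative interior of a facet, described by its
    only active constraint. The strict conditions persist under perturbation. *)
Definition on_facet (I : finType) (eta : I -> 'rV[R]_d) (c : I -> R) (j : I)
    p : Prop :=
  dot (eta j) p = c j /\ forall l, l != j -> c l < dot (eta l) p.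

(** The last clause is the irredundancy: a constraint that could be dropped, or that is listed
    twice, is never the only active one. *)
Definition irredundant P (I : finType) (eta : I -> 'rV[R]_d) (c : I -> R) :
    Prop :=
  [/\ forall i, dot (eta i) (eta i) = 1,
      P = [set x | forall i, c i <= dot (eta i) x],
      exists o, forall i, c i < dot (eta i) o &
      forall j, exists y, on_facet eta c j y].

Lemma mulmx_tr_dot u v : u *m v^T = (dot u v)%:M.
Proof.
apply/matrixP => i j; rewrite !mxE !ord1 eqxx mulr1n.
by apply: eq_bigr => k _; rewrite mxE.
Qed.

Lemma sub_kermx_dot u v : (u <= kermx v^T)%MS = (dot u v == 0).
Proof.
apply/sub_kermxP/eqP => [|uv]; rewrite mulmx_tr_dot.
  by move=> /matrixP/(_ 0 0); rewrite !mxE eqxx mulr1n.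
by rewrite uv raddf0.
Qed.

Lemma mxrank_kermx_dot v : v != 0 -> \rank (kermx v^T) = d.-1.
Proof. by move=> v0; rewrite mxrank_ker mxrank_tr rank_rV v0 subn1. Qed.

Lemma dot_affine_hull (A : set 'rV[R]_d) v (k : R) :
  (forall x, A x -> dot v x = k) -> forall x, affine_hull A x -> dot v x = k.
Proof.
move=> Ak _ [n [a [x [Ax a1 ->]]]]; rewrite dot_sumr.
under eq_bigr do rewrite dotZr (Ak _ (Ax _)).
by rewrite -mulr_suml a1 mul1r.
Qed.

Lemma affine_hull_line (A : set 'rV[R]_d) x y (t : R) :
  A x -> A y -> affine_hull A (x + t *: (y - x)).
Proof.
move=> Ax Ay; exists 2%N, (fun i => if i == 0 then 1 - t else t),
  (fun i => if i == 0 then x else y).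
split=> [i||]; [by case: ifP| |].
  by rewrite !big_ord_recl big_ord0 /= addr0 subrK.
rewrite !big_ord_recl big_ord0 /= addr0.
by rewrite scalerBr scalerBl scale1r -addrA [- _ + _]addrC.
Qed.

Lemma affine_hull_has_dim (A : set 'rV[R]_d) : has_dim A d ->
  affine_hull A = setT.
Proof.
move=> [x0 [B [rfB ->]]]; apply/seteqP; split=> // y _ /=.
by apply: submx_full; rewrite row_full_unit -row_free_unit.
Qed.

(** In the sum over [j], the term [j = i] is strict and the others are weak. One witness per
    constraint thus yields a common interior point. *)
Lemma lt_dot_average (I : finType) (eta y : I -> 'rV[R]_d) (c : I -> R) :
  (forall i j, c i <= dot (eta i) (y j)) ->
  (forall i, c i < dot (eta i) (y i)) ->
  forall i, c i < dot (eta i) (#|I|%:R^-1 *: \sum_j y j).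
Proof.
move=> cy cyi i.
have I0 : (0 < #|I|)%N by apply/card_gt0P; exists i.
rewrite dotZr ltr_pdivlMl ?ltr0n//.
have -> : dot (eta i) (\sum_j y j) = \sum_j dot (eta i) (y j).
  by elim/big_rec2: _ => [|k a b _ <-]; rewrite ?dot0r ?dotDr.
rewrite -sum1_card natr_sum mulr_suml (bigD1 i)//= [ltRHS](bigD1 i)//= mul1r.
by rewrite ltr_leD// ler_sum// => j _; rewrite mul1r.
Qed.

Lemma small_step (I : finType) (eta : I -> 'rV[R]_d) (c : I -> R) (A : pred I)
    z u :
  (forall j, A j -> c j < dot (eta j) z) ->
  exists2 s, 0 < s & forall j, A j -> c j < dot (eta j) (z + s *: u).
Proof.
move=> cz; near (0:R)^'+ => s; exists s; first by near: s; exact: nbhs_right_gt.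
near: s; apply: filter_forall => j.
have [Aj|_] := boolP (A j); last by near=> s.
have e0 : 0 < dot (eta j) z - c j by rewrite subr_gt0 cz.
have k0 : 0 < `|dot (eta j) u| + 1 by rewrite ltr_wpDl.
near=> s => _; rewrite dotDr dotZr.
have s0 : 0 < s by near: s; exact: nbhs_right_gt.
have : s < (dot (eta j) z - c j) / (`|dot (eta j) u| + 1).
  by near: s; apply: nbhs_right_lt; rewrite divr_gt0.
rewrite ltr_pdivlMr// => h.
have : - (s * `|dot (eta j) u|) <= s * dot (eta j) u.
  by rewrite -mulrN ler_pM2l// lerNl -normrN ler_norm.
lra.
Unshelve. all: by end_near. Qed.

(** A constraint that is tight on all of [P] is tight on the affine hull, which is the whole space;
    a nonzero linear form is not constant there. *)
Lemma polytope_interior P (I : finType) (a : I -> 'rV[R]_d) (c : I -> R) :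
  has_dim P d -> (forall i, a i != 0) ->
  P = [set x | forall i, c i <= dot (a i) x] ->
  exists o, forall i, c i < dot (a i) o.
Proof.
move=> Pd a0 PE.
have h i : exists y, P y /\ c i < dot (a i) y.
  apply: contrapT => /forallNP hN.
  have Pc y : P y -> dot (a i) y = c i.
    move=> Py; apply/eqP; rewrite eq_le [X in _ && X](_ : _ = true).
      by rewrite andbT leNgt; apply/negP => cy; exact: (hN y).
    by move: Py; rewrite PE => /(_ i).
  have aff y : dot (a i) y = c i.
    by apply: (dot_affine_hull Pc); rewrite affine_hull_has_dim.
  by have := a0 i; rewrite -dot_eq0 aff -(aff 0) dot0r eqxx.
have [y yP] := choice h.
exists (#|I|%:R^-1 *: \sum_j y j); apply: lt_dot_average => [i j|i].
  by have [+ _] := yP j; rewrite PE => /(_ i).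
by have [] := yP i.
Qed.

(** Among the sets of constraints that still describe [P], one of least cardinality is kept. *)
Lemma polytope_irredundant P : is_polytope P -> has_dim P d ->
  exists (I : finType) (eta : I -> 'rV[R]_d) (c : I -> R),
    irredundant P eta c.
Proof.
move=> [_ [N [a [c [a0 PE]]]]] Pd.
have [q qP] := polytope_interior Pd a0 PE.
pose rep (S : {set 'I_N}) :=
  `[< P = [set x | forall i, i \in S -> c i <= dot (a i) x] >].
have repT : rep [set: 'I_N]%SET.
  apply/asboolP; rewrite PE; apply/seteqP; split=> x /= h i //.
  by apply: h; rewrite finset.in_setT.
case: (arg_minnP (fun S : {set 'I_N} => #|S|) repT) => S repS Smin.
move/asboolP : (repS) => {}repS.
pose I : finType := {i : 'I_N | i \in S}.
have n0 i : 0 < enorm (a i) by rewrite lt_def enorm_eq0 a0 enorm_ge0.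
pose eta (i : I) := (enorm (a (val i)))^-1 *: a (val i).
pose c' (i : I) := (enorm (a (val i)))^-1 * c (val i).
have lec i x : (c' i <= dot (eta i) x) = (c (val i) <= dot (a (val i)) x).
  by rewrite dotZl ler_pM2l// invr_gt0.
have ltc i x : (c' i < dot (eta i) x) = (c (val i) < dot (a (val i)) x).
  by rewrite dotZl ltr_pM2l// invr_gt0.
exists I, eta, c'; split=> [i|||j].
- rewrite dotZl dotZr -sqr_enorm; have := n0 (val i) => h.
  by field; rewrite gt_eqF.
- rewrite repS; apply/seteqP; split=> x /= h i.
    by rewrite lec h// (valP i).
  by move=> iS; have := h (exist _ i iS); rewrite lec.
- by exists q => i; rewrite ltc.
(* By minimality, dropping constraint [val j] enlarges the set; a new point [z] violates that
   constraint alone. *)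
- have [z zP] : exists z, (forall i, i \in S -> i != val j ->
      c i <= dot (a i) z) /\ dot (a (val j)) z < c (val j).
    apply: contrapT => /forallNP hN.
    have : rep (S :\ val j)%SET.
      apply/asboolP; rewrite repS; apply/seteqP; split=> x /= h i.
        by move=> /finset.setD1P[_ /h].
      move=> iS; have [->|ij] := eqVneq i (val j); last first.
        by apply: h; rewrite finset.in_setD1 ij.
      rewrite leNgt; apply/negP => xj; apply: (hN x); split=> // l lS lj.
      by apply: h; rewrite finset.in_setD1 lj.
    move=> /Smin; rewrite [X in (X <= _)%N](finset.cardsD1 (val j)).
    by rewrite (valP j) ltnn.
  case: zP => zP zj.
  set k := c (val j) in zj *; set dz := dot (a (val j)) z in zj *.
  have := qP (val j); rewrite -/k => oj.
  set dO := dot (a (val j)) q in oj *.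
  (* The segment from the interior point [q] to [z] crosses the hyperplane of constraint [j] at
     parameter [t]. The other constraints are strict there, being strict at [q] and weak at [z],
     with [t < 1]. *)
  pose t := (dO - k) / (dO - dz).
  have den : 0 < dO - dz by lra.
  have t01 : 0 < t < 1.
    by apply/andP; split; rewrite /t ?divr_gt0 ?ltr_pdivrMr// ?mul1r; lra.
  exists (q + t *: (z - q)); split.
    rewrite /eta /c' dotZl; congr (_ * _); rewrite !dotE -/dO -/dz /t -/k.
    by field; rewrite gt_eqF.
  move=> l lj; rewrite ltc !dotE -/t.
  have zl := zP _ (valP l) lj; have ol := qP (val l).
  have /andP[t0 t1] := t01.
  have : t * c (val l) <= t * dot (a (val l)) z by rewrite ler_pM2l.
  have : (1 - t) * c (val l) < (1 - t) * dot (a (val l)) q.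
    by rewrite ltr_pM2l ?subr_gt0.
  lra.
Qed.

End HalfSpaces.

(** * Facets, their relative interiors and the skeleton in terms of active constraints *)

Section Facets.
Context {R : realType} {d : nat} (P : set 'rV[R]_d) (I : finType).
Context (eta : I -> 'rV[R]_d) (c : I -> R) (irrP : irredundant P eta c).
Implicit Types (x y z p e u v : 'rV[R]_d) (i j l : I).

Lemma eta_unit j : dot (eta j) (eta j) = 1.
Proof. by case: irrP. Qed.

Lemma eta_neq0 j : eta j != 0.
Proof. by rewrite -dot_eq0 eta_unit oner_eq0. Qed.

Lemma in_polytope x : P x <-> forall i, c i <= dot (eta i) x.
Proof. by case: irrP => _ -> _ _. Qed.

Lemma on_facet_in j p : on_facet eta c j p -> P p.
Proof.
move=> [jp lp]; apply/in_polytope => i.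
by have [->|/lp/ltW//] := eqVneq i j; rewrite jp.
Qed.

Lemma on_facet_inj i j p : on_facet eta c i p -> on_facet eta c j p -> i = j.
Proof.
move=> [ip _] [_ lp]; apply/eqP; apply: contraT => /lp.
by rewrite ip ltxx.
Qed.

Lemma face_facet j : face P (eta j) = P `&` [set x | dot (eta j) x = c j].
Proof.
have [_ _ _ /(_ j)[y yj]] := irrP; have Py := on_facet_in yj.
apply/seteqP; split=> x [Px /=] => [/(_ _ Py)|xj].
  rewrite yj.1 => h; split=> //; apply/eqP; rewrite eq_le h.
  by move/in_polytope : Px => /(_ j).
by split=> // z /in_polytope/(_ j); rewrite xj.
Qed.

Lemma affine_hull_facet j :
  affine_hull (face P (eta j)) = [set x | dot (eta j) x = c j].
Proof.
apply/seteqP; split=> [|x /= xj].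
  by apply: dot_affine_hull => x; rewrite face_facet => -[].
have [_ _ _ /(_ j)[y yj]] := irrP.
have [s s0 hs] := small_step (x - y) yj.2.
(* [y + s (x - y)] is a second point of the facet, and [x] lies on the line through it and [y]. *)
have -> : x = y + s^-1 *: ((y + s *: (x - y)) - y).
  by rewrite addrAC subrr add0r scalerA mulVf ?gt_eqF// scale1r addrC subrK.
apply: affine_hull_line; rewrite face_facet; split=> /=.
- exact: on_facet_in yj.
- by have [] := yj.
- apply/in_polytope => i; have [->|/hs/ltW//] := eqVneq i j.
  by rewrite !dotE xj yj.1 subrr mulr0 addr0.
- by rewrite !dotE xj yj.1 subrr mulr0 addr0.
Qed.

Lemma facet_normal_eta j : facet_normal P (eta j).
Proof.
split; first by rewrite /sphere /= /enorm eta_unit sqrtr1.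
have [_ _ _ /(_ j)[y yj]] := irrP.
have [B [rB BE]] : exists B : 'M[R]_(d.-1, d),
    row_free B /\ (B :=: kermx (eta j)^T)%MS.
  move: (row_base_free (kermx (eta j)^T)) (eq_row_base (kermx (eta j)^T)).
  move: (row_base (kermx (eta j)^T)); rewrite mxrank_kermx_dot ?eta_neq0// => B.
  by exists B.
exists y, B; split=> //; rewrite affine_hull_facet; apply/seteqP.
split=> x /=; rewrite BE sub_kermx_dot dotBl !(dotC _ (eta j)) yj.1.
  by move=> ->; rewrite subrr.
by rewrite subr_eq0 => /eqP.
Qed.

(* If no constraint were active on the whole face, an average of its points
   would lie in the interior of [P]. *)
Lemma face_sub_facet e : e != 0 -> face P e !=set0 ->
  exists j, forall x, face P e x -> dot (eta j) x = c j.
Proof.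
move=> e0 [x [Px xe]]; apply: contrapT => /forallNP hN.
have h j : exists y, face P e y /\ c j < dot (eta j) y.
  have /existsNP[y /not_implyP[ey yj]] := hN j; exists y; split=> //.
  rewrite lt_def; apply/andP; split; first exact/eqP.
  by case: ey => /in_polytope/(_ j).
have [y yP] := choice h.
have [z [ze zP]] : exists z, dot e z = dot e x /\
    forall i, true -> c i < dot (eta i) z.
  have [I0|I0] := posnP #|I|.
    by exists x; split=> // i; have := card0_eq I0 i.
  exists (#|I|%:R^-1 *: \sum_j y j); split.
    rewrite dotZr.
    have -> : dot e (\sum_j y j) = \sum_(j : I) dot e x.
      elim/big_rec2: _ => [|k a b _ <-]; first by rewrite dot0r.
      rewrite dotDr; congr (_ + _); apply/eqP; rewrite eq_le.
      have [[Py ye] _] := yP k.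
      by rewrite xe// ye.
    rewrite sumr_const -[dot e x *+ _]mulr_natl mulrA mulVf ?mul1r//.
    by rewrite pnatr_eq0 -lt0n.
  move=> i _; apply: lt_dot_average => [k j|k].
    by have [[/in_polytope + _] _] := yP j.
  by have [] := yP k.
have [s s0 zs] := small_step (- e) zP.
have /xe : P (z + s *: - e) by apply/in_polytope => i; exact/ltW/zs.
rewrite dotDr dotZr dotNr ze; have := mulr_gt0 s0 (_ : 0 < dot e e).
by rewrite dot_gt0 => /(_ e0); lra.
Qed.

(** The direction space of a face of dimension [d.-1] lies in the hyperplane orthogonal to some
    [eta j] and has the same rank, so [e] and [eta j] are both orthogonal to it and agree up to
    sign. *)
Lemma facet_normalP e : facet_normal P e <-> exists j, e = eta j.
Proof.
split=> [[e1 [x0 [B [rB aff]]]]|[j ->]]; last exact: facet_normal_eta.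
have ee : dot e e = 1 by rewrite -sqr_enorm e1 expr1n.
have e0 : e != 0 by rewrite -dot_eq0 ee oner_eq0.
have hx0 : affine_hull (face P e) x0 by rewrite aff /= subrr sub0mx.
have face0 : face P e !=set0.
  move: hx0 => [[|n] [a [x [ex a1 _]]]]; last by exists (x ord0).
  by move: a1; rewrite big_ord0 => /eqP; rewrite eq_sym oner_eq0.
have [j jP] := face_sub_facet e0 face0.
have [x1 [Px1 x1e]] := face0.
have eP x : face P e x -> dot e x = dot e x1.
  by move=> [Px xe]; apply/eqP; rewrite eq_le x1e// xe.
have subker v k : (forall x, face P e x -> dot v x = k) ->
    (B <= kermx v^T)%MS.
  move=> vk; apply/row_subP => i; rewrite sub_kermx_dot dotC.
  have : affine_hull (face P e) (x0 + row i B).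
    by rewrite aff /= addrAC subrr add0r row_sub.
  move=> /(dot_affine_hull vk); rewrite dotDr (dot_affine_hull vk hx0).
  by move=> /eqP; rewrite addrC -subr_eq0 addrK.
have kerj : (kermx (eta j)^T <= B)%MS.
  rewrite -(mxrank_leqif_sup (subker _ _ jP)) mxrank_kermx_dot ?eta_neq0//.
set q := dot e (eta j).
have : (e - q *: eta j <= kermx (eta j)^T)%MS.
  by rewrite sub_kermx_dot dotBl dotZl eta_unit mulr1 subrr.
move=> /submx_trans/(_ kerj)/submx_trans/(_ (subker _ _ eP)).
rewrite sub_kermx_dot dotBl dotZl ee (dotC (eta j)) -/q subr_eq0 eq_sym -expr2.
rewrite sqrf_eq1 => /orP[|] /eqP q1.
  exists j; apply/eqP; rewrite -subr_eq0 -dot_eq0 !dotE ee eta_unit.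
  by rewrite (dotC (eta j)) -/q q1; apply/eqP; ring.
(* The opposite sign would confine [P] to the wrong side of the facet, against the existence of an
   interior point. *)
have eN : e = - eta j.
  apply/eqP; rewrite -subr_eq0 -dot_eq0 !dotE ee eta_unit.
  by rewrite (dotC (eta j)) -/q q1; apply/eqP; ring.
have [_ _ [w wP] _] := irrP.
have /x1e : P w by apply/in_polytope => i; exact/ltW/wP.
have := jP x1 (conj Px1 x1e); have := wP j; rewrite eN !dotNl; lra.
Qed.

Lemma relint_facet j p : relint (face P (eta j)) p <-> on_facet eta c j p.
Proof.
split=> [[+ nearp]|jp].
  rewrite {1}face_facet => -[Pp jp]; split=> // l lj.
  rewrite lt_def; move/in_polytope : (Pp) => /(_ l) ->; rewrite andbT.
  apply/eqP => lp.
  have [_ _ _ /(_ j)[y yj]] := irrP.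
  (* If constraint [l] is active at [p], moving from [p] away from the point [y], where [l] is
     slack, violates [l] without leaving the affine hull. *)
  have cvgs : p + s *: (p - y) @[s --> (0:R)^'+] --> p.
    have : p + s *: (p - y) @[s --> (0:R)^'+] --> p + 0 *: (p - y).
      apply: cvgD; first exact: cvg_cst.
      by apply: cvgZr_tmp; apply: cvg_at_right_filter; exact: cvg_id.
    by rewrite scale0r addr0.
  have /filter_ex[s [s0 hs]] : \forall s \near (0:R)^'+, 0 < s /\
      face P (eta j) (p + s *: (p - y)).
    apply: filterS2 (nbhs_right_gt (0:R)) (cvgs _ nearp) => s s0 hs.
    split=> //; apply: hs; rewrite affine_hull_facet /= !dotE jp yj.1.
    by rewrite subrr mulr0 addr0.
  move: hs => [/in_polytope/(_ l)]; rewrite !dotE lp => h _.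
  have := yj.2 l lj; rewrite -subr_gt0 => yl.
  have := mulr_gt0 s0 yl; lra.
have fp : face P (eta j) p.
  by rewrite face_facet; split; [exact: on_facet_in jp|have [] := jp].
split=> //=; rewrite affine_hull_facet.
have : \forall y \near p, forall l, l != j -> c l < dot (eta l) y.
  apply: (@filter_forall _ _ (fun l y => l != j -> c l < dot (eta l) y)
    (nbhs p) (nbhs_filter p)) => l.
  have [lj|_] := boolP (l != j); last by near=> y.
  have : dot (eta l) y @[y --> p] --> dot (eta l) p.
    by apply: cvg_dot; [exact: cvg_cst|exact: cvg_id].
  move=> /cvgr_gt/(_ _ (jp.2 l lj)); exact: filterS.
apply: filterS => y yl yj; rewrite face_facet; split=> //.
by apply/in_polytope => i; have [->|/yl/ltW//] := eqVneq i j; rewrite yj.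
Unshelve. all: by end_near. Qed.

Lemma normal_ofP p e :
  normal_of P p e <-> exists j, e = eta j /\ on_facet eta c j p.
Proof.
split=> [[/facet_normalP[j ->] /relint_facet jp]|[j [-> jp]]].
  by exists j.
by split; [exact: facet_normal_eta|exact/relint_facet].
Qed.

Lemma normal_at_facet j p : on_facet eta c j p -> normal_at P p = eta j.
Proof.
move=> jp; apply: xget_unique; first by apply/normal_ofP; exists j.
by move=> e /normal_ofP[i [-> /on_facet_inj/(_ jp) ->]].
Qed.

(** A facet is closed, so its relative boundary consists of its points where a further constraint is
    active. *)
Lemma skeletonP z :
  skeleton P z <-> P z /\ exists i j, [/\ i != j, dot (eta i) z = c i &
                                         dot (eta j) z = c j].
Proof.
have clP j : closed (face P (eta j)).
  have -> : face P (eta j) =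
      \bigcap_i [set x | c i <= dot (eta i) x] `&`
      [set x | dot (eta j) x <= c j].
    apply/seteqP; split=> x; rewrite face_facet.
      move=> [/in_polytope Px xj]; split=> [i _|/=]; first exact: Px.
      by rewrite xj.
    move=> [Px xj]; have PPx : P x by apply/in_polytope => i; exact: Px.
    by split=> //=; apply/eqP; rewrite eq_le xj; exact: Px.
  have ct i : continuous (fun x => dot (eta i) x).
    by move=> x; apply: cvg_dot; [exact: cvg_cst|exact: cvg_id].
  apply: closedI; first apply: closed_bigI => i _.
    exact: (preimage_closed (fun x _ => ct i x) (@closed_ge _ (c i))).
  exact: (preimage_closed (fun x _ => ct j x) (@closed_le _ (c j))).
split.
  move=> [e /facet_normalP[j ->] []]; rewrite -(closure_id _).1//.
  rewrite {1}face_facet => -[Pz jz] nz; split=> //.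
  have /existsNP[l /not_implyP[lj /negP lz]] :
      ~ forall l, l != j -> c l < dot (eta l) z.
    by move=> h; apply: nz; apply/relint_facet.
  exists l, j; split=> //; apply/eqP; rewrite eq_le leNgt lz.
  by move/in_polytope : Pz => /(_ l) ->.
move=> [Pz [i [j [ij iz jz]]]].
exists (eta j); first exact: facet_normal_eta.
split; first by apply: subset_closure; rewrite face_facet.
by move=> /relint_facet[_ /(_ _ ij)]; rewrite iz ltxx.
Qed.

End Facets.

(** * Collisions *)

Section Collisions.
Context {R : realType} {d : nat} (f : R -> R) (P : set 'rV[R]_d) (I : finType).
Context (eta : I -> 'rV[R]_d) (c : I -> R) (irrP : irredundant P eta c).
Context (cP : compact P).
Implicit Types (p v e : 'rV[R]_d) (i j l : I) (x : phase R d).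

Definition on_wall i x : Prop :=
  [/\ on_facet eta c i x.1, enorm x.2 = 1 & 0 < dot (eta i) x.2].

Definition wall_time j x : R := (dot (eta j) x.1 - c j) / - dot (eta j) x.2.

(** Only the landing point is constrained: for a point of a wall, convexity rules out earlier
    collisions. In this form the condition is open. *)
Definition hits j x : Prop := dot (eta j) x.2 < 0 /\
  forall l, l != j -> c l < dot (eta l) (x.1 + wall_time j x *: x.2).

Definition collide j x : phase R d :=
  (x.1 + wall_time j x *: x.2,
   law_map f (eta j) (reflection (eta j) x.2)).

Lemma M_on_wall x : M P x <-> exists i, on_wall i x.
Proof.
split=> [[e /(normal_ofP irrP)[i [-> ix]] [x1 xi]]|[i [ix x1 xi]]].
  by exists i; split=> //; rewrite dotC.
exists (eta i); last by split=> //=; rewrite dotC.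
by apply/(normal_ofP irrP); exists i.
Qed.

Lemma polytope_bounded : exists L, forall p, P p -> enorm p <= L.
Proof.
have /compact_bounded[L [_ hL]] : compact (@enorm R d @` P).
  apply: continuous_compact => //; apply: continuous_subspaceT => x.
  by apply: cvg_enorm; exact: cvg_id.
exists (L + 1) => p Pp; have := hL (L + 1); rewrite ltrDl ltr01.
move=> /(_ isT (enorm p) (ex_intro2 _ _ p Pp erefl)) /=.
by rewrite ger0_norm ?enorm_ge0.
Qed.

Lemma dot_wall_time j x : dot (eta j) x.2 < 0 ->
  dot (eta j) (x.1 + wall_time j x *: x.2) = c j.
Proof.
move=> xj; rewrite dotDr dotZr /wall_time; field.
by rewrite lt_eqF.
Qed.

Lemma hits_on_facet j x : hits j x ->
  on_facet eta c j (x.1 + wall_time j x *: x.2).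
Proof. by move=> [xj xl]; split=> //; exact: dot_wall_time. Qed.

Lemma wall_time_gt0 i j x : on_wall i x -> dot (eta j) x.2 < 0 ->
  0 < wall_time j x.
Proof.
move=> [[_ xl] _ xi] xj; rewrite divr_gt0 ?oppr_gt0// subr_gt0 xl//.
by apply: contraTneq xj => ->; rewrite -leNgt ltW.
Qed.

(** The slack of a constraint is affine in time, hence a weighted mean of its values at departure
    and landing; at departure it is positive except on wall [i], which the velocity leaves. *)
Lemma inside_before_hit i j x t : on_wall i x -> hits j x ->
  0 < t < wall_time j x -> forall l, c l < dot (eta l) (x.1 + t *: x.2).
Proof.
move=> xi hj /andP[t0 tT] l; have T0 := wall_time_gt0 xi hj.1.
have := in_polytope irrP (x.1 + wall_time j x *: x.2).
move=> -[/(_ (on_facet_in irrP (hits_on_facet hj)))/(_ l) + _].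
move: xi => [[xi xl] _ vi].
have [->|/xl] := eqVneq l i; rewrite !dotDr !dotZr => h.
  by rewrite xi ltrDl mulr_gt0.
set T := wall_time j x in tT T0 * => h2.
rewrite -subr_gt0 -(pmulr_rgt0 _ T0).
have : 0 < (T - t) * (dot (eta l) x.1 - c l) by rewrite mulr_gt0 ?subr_gt0.
have : 0 <= t * (dot (eta l) x.1 + T * dot (eta l) x.2 - c l).
  by rewrite mulr_ge0 ?subr_ge0// ltW.
lra.
Qed.

Lemma outside_after_hit j x t : dot (eta j) x.2 < 0 -> wall_time j x < t ->
  ~ P (x.1 + t *: x.2).
Proof.
move=> xj tT /(in_polytope irrP)/(_ j); have := dot_wall_time xj.
rewrite !dotDr !dotZr => h1 h2.
have : 0 < (t - wall_time j x) * - dot (eta j) x.2.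
  by rewrite mulr_gt0 ?subr_gt0 ?oppr_gt0.
lra.
Qed.

Lemma skeletonN_on_facet i p : on_facet eta c i p -> ~ skeleton P p.
Proof.
move=> [_ lp] /(skeletonP irrP)[_ [j [l [jl jp lp']]]].
have [ji|/lp] := eqVneq j i; last by rewrite jp ltxx.
by have := lp l; rewrite -ji eq_sym lp' ltxx => /(_ jl).
Qed.

Lemma skeletonN_inside p : (forall l, c l < dot (eta l) p) -> ~ skeleton P p.
Proof.
move=> pl /(skeletonP irrP)[_ [j [_ [_ jp _]]]].
by have := pl j; rewrite jp ltxx.
Qed.

Lemma hits_M' i j x : on_wall i x -> hits j x -> M' P x.
Proof.
move=> xi hj; split; first by apply/M_on_wall; exists i.
move=> t; rewrite le_eqVlt => /predU1P[<-|t0].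
  by rewrite scale0r addr0; case: xi => /skeletonN_on_facet.
have [tT|tT|->] := ltgtP t (wall_time j x).
- by apply/skeletonN_inside/(inside_before_hit xi hj); rewrite t0.
- by move=> /(skeletonP irrP)[/(outside_after_hit hj.1 tT)].
- exact: skeletonN_on_facet (hits_on_facet hj).
Qed.

Lemma M'_hits x : M' P x -> exists i j, on_wall i x /\ hits j x.
Proof.
move=> [/M_on_wall[i xi] nskel]; exists i.
have [L hL] := polytope_bounded.
have Px : P x.1 by case: xi => /(on_facet_in irrP).
have x1 : enorm x.2 = 1 by case: xi.
have [l0 xl0] : exists l, dot (eta l) x.2 < 0.
  apply: contrapT => /forallNP hN.
  have L0 : 0 <= L by rewrite (le_trans _ (hL _ Px))// enorm_ge0.
  (* If no wall is approached, the ray stays in [P]; by this time it has moved farther than the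
     bound [L] allows. *)
  pose t := L + enorm x.1 + 1.
  have t0 : 0 <= t by rewrite !addr_ge0 ?enorm_ge0.
  have /hL : P (x.1 + t *: x.2).
    apply/(in_polytope irrP) => l; rewrite dotDr dotZr.
    move/(in_polytope irrP) : Px => /(_ l) /le_trans; apply.
    by rewrite lerDl mulr_ge0// leNgt; exact/negP.
  have := ler_enormB (x.1 + t *: x.2) x.1.
  rewrite addrAC subrr add0r enormZ x1 mulr1 ger0_norm//.
  rewrite /t; lra.
(* The wall hyperplane reached first. The landing point is then in [P], and a second active
   constraint would put it on the skeleton. *)
case: (@arg_minP _ R I l0 (fun l => dot (eta l) x.2 < 0)
  (fun l => wall_time l x) xl0) => j xj jmin.
exists j; split=> //; split=> //.
have T0 := wall_time_gt0 xi xj.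
have Pq : P (x.1 + wall_time j x *: x.2).
  apply/(in_polytope irrP) => l; have [xl|xl] := ltP (dot (eta l) x.2) 0.
    rewrite -(dot_wall_time xl) !dotDr !dotZr lerD2l ler_wnM2r ?jmin// ltW//.
  rewrite dotDr dotZr; move/(in_polytope irrP) : Px => /(_ l) /le_trans; apply.
  by rewrite lerDl mulr_ge0// ltW.
move=> l lj; rewrite lt_def; move/(in_polytope irrP) : (Pq) => /(_ l) ->.
rewrite andbT; apply/eqP => lq; apply: (nskel _ (ltW T0)).
apply/(skeletonP irrP); split=> //; exists l, j; split=> //.
exact: dot_wall_time.
Qed.

(** The set of admissible times is a singleton: the ray is in the interior before the landing and
    outside [P] after it. *)
Lemma hit_timeE i j x : on_wall i x -> hits j x ->
  hit_time P x = wall_time j x.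
Proof.
move=> xi hj; rewrite /hit_time -[RHS]inf1; congr inf; apply/seteqP.
split=> t /= => [[t0 [e /(normal_ofP irrP)[l [_ tl]]]]|->].
  have [tT|/(outside_after_hit hj.1)|//] := ltgtP t (wall_time j x).
    have := inside_before_hit xi hj (t := t); rewrite t0 tT => /(_ isT l).
    by rewrite tl.1 ltxx.
  by case; exact: on_facet_in tl.
split; first exact: wall_time_gt0 xi hj.1.
exists (eta j); apply/(normal_ofP irrP); exists j; split=> //.
exact: hits_on_facet.
Qed.

Lemma Phi_collide i j x : on_wall i x -> hits j x -> Phi f P x = collide j x.
Proof.
move=> xi hj; rewrite /Phi (hit_timeE xi hj).
by rewrite (normal_at_facet irrP (hits_on_facet hj)).
Qed.

End Collisions.

(** * Contracting laws *)

Section Quotients.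
Context {R : realType} {V : normedModType R}.

Lemma is_derive0P (g : R -> V) w :
  is_derive (0 : R) 1 g w <-> h^-1 *: (g h - g 0) @[h --> 0^'] --> w.
Proof.
have E : (fun h : R => h^-1 *: (g h - g 0)) =
    (fun h : R => h^-1 *: ((g \o shift 0) (h *: 1) - g 0)).
  by apply/funext => h /=; rewrite addr0 /GRing.scale /= mulr1.
rewrite E; split=> [[gd <-]|h]; first exact: gd.
by split; [apply/cvg_ex; exists w|exact: cvg_lim].
Qed.

End Quotients.

Section ScalarLaw.
Context {R : realType} (f : R -> R) (hf : contracting_law f).
Implicit Types s t x y : R.

(** The derivative of [sin (mu * x) - mu * sin x] is nonnegative because cosine decreases on
    [[0, pi]]; the mean value theorem concludes. *)
Lemma sin_concave (mu x : R) : 0 <= mu <= 1 -> 0 <= x <= pi ->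
  mu * sin x <= sin (mu * x).
Proof.
move=> /andP[mu0 mu1] /andP[x0 xpi].
pose g : R -> R := fun y => sin (mu * y) - mu * sin y.
have gd y : is_derive y 1 g (mu * (cos (mu * y) - cos y)).
  have h1 : is_derive y 1 (fun y => mu * y) mu.
    by apply: is_derive_eq; rewrite /GRing.scale /=; ring.
  have h2 : is_derive y 1 (fun y => sin (mu * y)) (cos (mu * y) * mu).
    exact: (@is_derive1_comp _ (@sin R) (fun y => mu * y)).
  have -> : g = (fun y => sin (mu * y)) - mu *: (@sin R) by [].
  by apply: is_derive_eq; rewrite /GRing.scale /=; ring.
have gc : {within `[0, x], continuous g}.
  apply: continuous_subspaceT => y.
  apply: differentiable_continuous; apply/derivable1_diffP.
  exact: (@ex_derive _ _ _ _ _ _ _ (gd y)).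
have [z] := MVT_segment x0 (fun y _ => gd y) gc.
rewrite in_itv /= => /andP[z0 zx].
rewrite /g (mulr0 mu) sin0 mulr0 !subr0 => h.
rewrite -subr_ge0 h !mulr_ge0// subr_ge0.
rewrite le_eqVlt; have [->|muz] := eqVneq (mu * z) z; first by rewrite eqxx.
apply/orP; right; rewrite ltr_cos ?in_itv /= ?z0 ?mulr_ge0 ?(le_trans zx)//=.
- by rewrite lt_neqAle muz ler_piMl.
- by rewrite (le_trans _ (le_trans zx xpi))// ler_piMl.
Qed.

(** Twice the left side is the squared chord between two points of the unit circle, so contraction
    of chords becomes an inequality between sines of half angles. *)
Lemma cosB_half x y : 1 - cos (x - y) = 2 * sin (`|x - y| / 2) ^+ 2.
Proof.
have {1}-> : x - y = Num.sg (x - y) * (`|x - y| / 2 + `|x - y| / 2).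
  by rewrite -splitr -numEsg.
have [->|xy] := eqVneq (x - y) 0.
  by rewrite normr0 sgr0 !mul0r cos0 sin0; ring.
rewrite cos_sg // cosD -!expr2; have := cos2Dsin2 (`|x - y| / 2); lra.
Qed.

Lemma law_sup : exists lam, [/\ 0 <= lam, lam < 1 &
  exists f1 : R -> R, is_derive_on (@dom_law R) f f1 /\
    forall t, dom_law t -> `|f1 t| <= lam].
Proof.
case: hf => _ _ [f1 [f2 [df _ _ /andP[s0 s1]]]].
set S := ereal_sup _ in s0 s1.
have Sfin : S \is a fin_num.
  by rewrite fin_real// (lt_le_trans _ (ltW s0)) ?ltNyr//= (lt_trans s1) ?ltry.
exists (fine S); split; [by rewrite fine_ge0// ltW| |].
  by rewrite -lte_fin fineK.
exists f1; split=> // t td; rewrite -lee_fin fineK//.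
by apply: ereal_sup_ubound; exists t.
Qed.

Section Derivative.
Context (f1 : R -> R) (df : is_derive_on (@dom_law R) f f1).

Lemma law_derive x : 0 < x < pi / 2 -> is_derive x 1 f (f1 x).
Proof.
move=> /andP[x0 xpi].
suff h : h^-1 *: ((f \o shift x) (h *: 1) - f x) @[h --> 0^'] --> f1 x.
  by split; [apply/cvg_ex; exists (f1 x)|exact: cvg_lim].
apply/cvgrPdist_lt => e e0.
have xd : dom_law x by rewrite /dom_law /= in_itv /= ltW.
move/cvgrPdist_lt : (df xd) => /(_ e e0) hnear.
have cvgx : h + x @[h --> (0 : R)] --> x.
  by rewrite -[X in _ --> X]add0r; apply: cvgD; [exact: cvg_id|exact: cvg_cst].
have /cvgx hdom : \forall y \near x, 0 < y < pi / 2.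
  near=> y; apply/andP; split; near: y; [exact: lt_nbhsr|exact: lt_nbhsl].
move/cvgx : hnear => hnear; near=> h.
have h0 : h != 0 by near: h; exact: nbhs_dnbhs_neq.
have : 0 < h + x < pi / 2 by near: h; apply: nbhs_dnbhs; exact: hdom.
move=> /andP[hx0 hxpi].
have -> : h^-1 *: ((f \o shift x) (h *: 1) - f x) =
    (f (h + x) - f x) / (h + x - x).
  by rewrite addrK mulrC /GRing.scale /= mulr1.
have : (dom_law `\ x) (h + x) -> `|f1 x - (f (h + x) - f x) / (h + x - x)| < e.
  by near: h; apply: nbhs_dnbhs; exact: hnear.
apply; split; first by rewrite /dom_law /= in_itv /= ltW.
by apply/eqP; rewrite -subr_eq0 addrK.
Unshelve. all: by end_near. Qed.

(** The mean value theorem needs continuity at the left endpoint 0, where only a one-sided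
    derivative is given. *)
Lemma law_cvg0 : f x @[x --> (0 : R)^'+] --> 0.
Proof.
have d0 : dom_law (0 : R).
  by rewrite /dom_law /= in_itv /= lexx divr_gt0 ?pi_gt0.
have f0 : f 0 = 0 by case: hf.
have q : (f y - f 0) / (y - 0) @[y --> (0 : R)^'+] --> f1 0.
  apply: cvg_trans (df d0); apply: cvg_app => A hA; near=> y.
  have : (dom_law `\ (0 : R)) y -> A y.
    by near: y; apply: cvg_within; exact: hA.
  have y0 : 0 < y by near: y; exact: nbhs_right_gt.
  have ypi : y < pi / 2.
    by near: y; apply: nbhs_right_lt; rewrite divr_gt0 ?pi_gt0.
  apply; split; first by rewrite /dom_law /= in_itv /= ltW.
  by apply/eqP; rewrite gt_eqF.
have : (f y - f 0) / (y - 0) * y @[y --> (0 : R)^'+] --> f1 0 * 0.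
  by apply: cvgM q _; apply: cvg_at_right_filter; exact: cvg_id.
rewrite mulr0; apply: cvg_trans; apply: near_eq_cvg; near=> y.
have y0 : 0 < y by near: y; exact: nbhs_right_gt.
by rewrite f0 !subr0 divfK// gt_eqF.
Unshelve. all: by end_near. Qed.

Lemma law_lipschitz_lt (lam s t : R) :
  (forall t, dom_law t -> `|f1 t| <= lam) -> 0 <= s -> s < t -> t < pi / 2 ->
  `|f t - f s| <= lam * (t - s).
Proof.
move=> flam s0 st tpi.
have fd x : x \in `]s, t[ -> is_derive x 1 f (f1 x).
  rewrite in_itv /= => /andP[sx xt]; apply: law_derive.
  by rewrite (le_lt_trans s0 sx) (lt_trans xt tpi).
have fcont x : 0 < x < pi / 2 -> f y @[y --> x] --> f x.
  move=> /law_derive fx; apply: differentiable_continuous.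
  exact: (derivable1_diffP _ _).1 (@ex_derive _ _ _ _ _ _ _ fx).
have fc : {within `[s, t], continuous f}.
  apply/continuous_within_itvP => //; split.
  - move=> x; rewrite in_itv /= => /andP[sx xt]; apply: fcont.
    by rewrite (le_lt_trans s0 sx) (lt_trans xt tpi).
  - move: s0; rewrite le_eqVlt => /predU1P[<-|s0].
      by have [_ -> _] := hf; exact: law_cvg0.
    by apply: cvg_at_right_filter; apply: fcont; rewrite s0 (lt_trans st tpi).
  - apply: cvg_at_left_filter; apply: fcont.
    by rewrite (le_lt_trans s0 st) tpi.
have [x] := MVT st fd fc; rewrite in_itv /= => /andP[sx xt] ->.
rewrite normrM (gtr0_norm (_ : 0 < t - s)) ?subr_gt0//.
rewrite ler_wpM2r ?subr_ge0 ?(ltW st)// flam// /dom_law /= in_itv /=.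
by rewrite (ltW (le_lt_trans s0 sx)) (lt_trans xt tpi).
Qed.

Lemma law_lipschitz (lam s t : R) :
  (forall t, dom_law t -> `|f1 t| <= lam) -> dom_law s -> dom_law t ->
  `|f t - f s| <= lam * `|t - s|.
Proof.
move=> flam; rewrite /dom_law /= !in_itv /= => /andP[s0 spi] /andP[t0 tpi].
have [st|ts|->] := ltgtP s t.
- by rewrite [in leRHS]gtr0_norm ?subr_gt0// law_lipschitz_lt.
- rewrite distrC [in leRHS]distrC [in leRHS]gtr0_norm ?subr_gt0//.
  exact: law_lipschitz_lt.
- by rewrite !subrr !normr0 mulr0.
Qed.

End Derivative.

(* The ratio [sin (lam * x) / sin x] increases with [x], so that [lam] itself
   is not a Lipschitz constant of the law for the chordal metric. *)
Lemma sin_shrink (lam : R) : 0 <= lam -> lam < 1 ->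
  exists kap, [/\ 0 <= kap, kap < 1 &
    forall x, 0 <= x <= pi / 2 -> sin (lam * x) <= kap * sin x].
Proof.
move=> lam0 lam1; have pi0 := pi_gt0 R.
(* [sin x - sin (lam * x) = 2 * (cos a * sin b)] with [a] at most [(1 + lam) * (pi / 4)], so [cos a]
   is at least [m], and concavity gives [sin b >= (1 - lam) / 2 * sin x]. Hence the constant
   [1 - (1 - lam) * m]. *)
pose m : R := cos ((1 + lam) * (pi / 4)).
have lampi : lam * pi < pi by rewrite gtr_pMl.
have lampi0 : 0 <= lam * pi by rewrite mulr_ge0// ltW.
have m0 : 0 < m.
  apply: cos_gt0_pihalf.
  have -> : (1 + lam) * (pi / 4) = pi / 4 + lam * pi / 4 :> R by field.
  by apply/andP; split; lra.
have m1 : m <= 1 := cos_le1 _.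
have l1m0 : 0 < (1 - lam) * m by rewrite mulr_gt0 ?subr_gt0.
have l1m1 : (1 - lam) * m <= 1.
  by rewrite (le_trans _ m1)// ler_piMl ?(ltW m0)//; lra.
exists (1 - (1 - lam) * m); split; [lra|lra|].
move=> x /andP[x0 xpi].
have sx : 0 <= sin x by rewrite sin_ge0_pi// x0; lra.
have lamx : lam * x <= x by rewrite ler_piMl// ltW.
have lamx0 : 0 <= lam * x by rewrite mulr_ge0.
set a := (1 + lam) / 2 * x; set b := (1 - lam) / 2 * x.
have E : sin x - sin (lam * x) = 2 * (cos a * sin b).
  have -> : x = a + b by rewrite /a /b; field.
  have -> : lam * (a + b) = a - b by rewrite /a /b; field.
  by rewrite sinD sinB; ring.
have ma : m <= cos a.
  rewrite le_eqVlt; have [->|am] := eqVneq a ((1 + lam) * (pi / 4)).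
    by rewrite eqxx.
  apply/orP; right; rewrite ltr_cos ?in_itv /=.
  - rewrite lt_neqAle am /a -mulrA ler_wpM2l//; lra.
  - have -> : a = (x + lam * x) / 2 by rewrite /a; field.
    by apply/andP; split; lra.
  - have -> : (1 + lam) * (pi / 4) = pi / 4 + lam * pi / 4 :> R by field.
    by apply/andP; split; lra.
have sb : (1 - lam) / 2 * sin x <= sin b.
  by apply: sin_concave; apply/andP; split; lra.
have : m * ((1 - lam) / 2 * sin x) <= cos a * sin b.
  by rewrite ler_pM ?mulr_ge0 ?(ltW m0)//; lra.
lra.
Qed.

(** Both estimates come from [sin_shrink]: the first through [f t <= lam * t], the second through
    the Lipschitz bound on half of [f t - f s]. The square of [kap] appears because [1 - cos] is
    half a squared chord. *)
Lemma law_contraction : exists kap : R, [/\ 0 <= kap, kap < 1,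
  forall t, dom_law t -> sin (f t) <= kap * sin t &
  forall s t, dom_law s -> dom_law t ->
    1 - cos (f t - f s) <= kap ^+ 2 * (1 - cos (t - s))].
Proof.
have [lam [lam0 lam1 [f1 [df flam]]]] := law_sup.
have [kap [kap0 kap1 hk]] := sin_shrink lam0 lam1.
have [fdom f0 _] := hf; have pi0 := pi_gt0 R.
have flip := law_lipschitz df flam.
have sin_le y z : 0 <= y -> y <= z -> z <= pi / 2 -> sin y <= sin z.
  move=> y0; rewrite le_eqVlt => /predU1P[->//|yz] zpi.
  by apply/ltW; rewrite ltr_sin// in_itv /=; apply/andP; split; lra.
have d0 : dom_law (0 : R) by rewrite /dom_law /= in_itv /= lexx divr_gt0.
exists kap; split=> // [t td|s t sd td].
  have := td; have := fdom _ td; rewrite /dom_law /= !in_itv /=.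
  move=> /andP[ft0 ftpi] /andP[t0 tpi].
  apply: le_trans (hk t _); last by rewrite t0 ltW.
  have := flip _ _ d0 td; rewrite f0 !subr0 !ger0_norm// => h.
  by apply: sin_le => //; rewrite (le_trans _ (ltW tpi))// ler_piMl// ltW.
rewrite !cosB_half [leRHS]mulrCA ler_pM2l// -exprMn.
have := sd; have := td; rewrite /dom_law /= !in_itv /=.
move=> /andP[t0 tpi] /andP[s0 spi].
have D1 : `|t - s| <= pi / 2 by rewrite ler_norml; apply/andP; split; lra.
have h := flip _ _ sd td.
have D0 := normr_ge0 (t - s); have E0 := normr_ge0 (f t - f s).
have E1 : `|f t - f s| <= pi / 2.
  by rewrite (le_trans h)// (le_trans _ D1)// ler_piMl// ltW.
have h2 : sin (`|f t - f s| / 2) <= kap * sin (`|t - s| / 2).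
  apply: le_trans (hk _ _); last by apply/andP; split; lra.
  apply: sin_le; [lra| by rewrite mulrA ler_pM2r|].
  rewrite mulrA (le_trans _ (_ : `|t - s| / 2 <= _))//; last by lra.
  by rewrite ler_pM2r// ler_piMl// ltW.
have s0' : 0 <= sin (`|f t - f s| / 2).
  by rewrite sin_ge0_pi//; apply/andP; split; lra.
by rewrite ler_pXn2r// nnegrE// (le_trans s0').
Qed.

End ScalarLaw.

(** * The law as a contraction of the half sphere for the chordal metric *)

Section SphereLaw.
Context {R : realType} {d : nat} (f : R -> R) (hf : contracting_law f).
Context (eta : 'rV[R]_d) (eta1 : dot eta eta = 1).
Implicit Types (u v w : 'rV[R]_d) (s t : R).

Lemma enorm_eq1 v : (enorm v == 1) = (dot v v == 1).
Proof. by rewrite -sqr_enorm sqrp_eq1// enorm_ge0. Qed.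

Lemma half_sphereP v : half_sphere eta v <-> dot v v = 1 /\ 0 < dot v eta.
Proof.
split=> -[/eqP + v0]; last by rewrite -enorm_eq1 => /eqP.
by rewrite enorm_eq1 => /eqP.
Qed.

Let ang v := acos (dot v eta).

(** The factor applied to the tangential part. At [v = eta] the division by zero gives 0, which is
    harmless since the tangential part vanishes. *)
Definition law_ratio v : R := sin (f (ang v)) / sin (ang v).

Lemma dot_half_sphere v : half_sphere eta v -> 0 < dot v eta <= 1.
Proof.
move=> /half_sphereP[v1 v0]; rewrite v0 /=.
have := dot_sqr_le v eta; rewrite v1 eta1 mulr1 => h.
rewrite -[leRHS]ger0_norm// -[leLHS]ger0_norm ?(ltW v0)//.
by rewrite -ler_sqr ?nnegrE// !real_normK ?num_real// expr1n.
Qed.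

Lemma cos_ang v : half_sphere eta v -> cos (ang v) = dot v eta.
Proof.
move=> /dot_half_sphere/andP[v0 v1]; rewrite acosK// in_itv /= v1 andbT.
by rewrite (le_trans _ (ltW v0))// lerN10.
Qed.

Lemma ang_dom v : half_sphere eta v -> dom_law (ang v).
Proof.
move=> hv; have /andP[v0 v1] := dot_half_sphere hv.
have vN : -1 <= dot v eta <= 1 by rewrite v1 (le_trans _ (ltW v0))// lerN10.
rewrite /dom_law /= in_itv /= acos_ge0//= -ltr_cos.
- by rewrite cos_ang// cos_pihalf.
- by rewrite in_itv /= acos_ge0 ?acos_lepi.
- by rewrite in_itv /=; have := pi_gt0 R; lra.
Qed.

Lemma sin_dom_ge0 t : dom_law t -> 0 <= sin t.
Proof.
rewrite /dom_law /= in_itv /= => /andP[t0 tpi]; rewrite sin_ge0_pi// t0 /=.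
by have := pi_gt0 R; lra.
Qed.

Lemma sin_dom_eq0 t : dom_law t -> (sin t == 0) = (t == 0).
Proof.
rewrite /dom_law /= in_itv /= => /andP[t0 tpi].
apply/idP/eqP => [s0|->]; last by rewrite sin0.
apply: contraTeq s0 => tn; rewrite gt_eqF// sin_gt0_pihalf//.
by rewrite lt_def tn t0.
Qed.

Lemma dot_proj_orth v w : dot (proj_orth eta v) (proj_orth eta w) =
  dot v w - dot v eta * dot w eta.
Proof. by rewrite !dotE eta1 (dotC eta w); ring. Qed.

Lemma sin_ang_sqr v : half_sphere eta v ->
  sin (ang v) ^+ 2 = dot (proj_orth eta v) (proj_orth eta v).
Proof.
move=> hv; have [v1 _] := (half_sphereP v).1 hv.
rewrite dot_proj_orth v1 -(cos_ang hv); have := cos2Dsin2 (ang v); lra.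
Qed.

Lemma law_ratioK v : half_sphere eta v ->
  law_ratio v * sin (ang v) = sin (f (ang v)).
Proof.
move=> hv; rewrite /law_ratio; have := sin_dom_eq0 (ang_dom hv).
have [->|sn _] := eqVneq (sin (ang v)) 0; last by rewrite divfK.
by move=> /esym/eqP ->; have [_ -> _] := hf; rewrite sin0 mulr0.
Qed.

Lemma law_mapE v : half_sphere eta v ->
  law_map f eta v = cos (f (ang v)) *: eta + law_ratio v *: proj_orth eta v.
Proof.
move=> hv; rewrite /law_map -/(ang v) /proj scalerA; congr (_ *: _ + _).
rewrite cos_ang// divfK// gt_eqF//.
by have /andP[] := dot_half_sphere hv.
Qed.

Lemma dot_law_map_eta v : half_sphere eta v ->
  dot (law_map f eta v) eta = cos (f (ang v)).
Proof.
by move=> hv; rewrite law_mapE// !dotE eta1; ring.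
Qed.

Lemma dot_law_map_orth u v : dot eta u = 0 -> half_sphere eta v ->
  dot u (law_map f eta v) = law_ratio v * dot u v.
Proof.
by move=> etau hv; rewrite law_mapE// !dotE (dotC u eta) etau; ring.
Qed.

Lemma dot_law_map v w : half_sphere eta v -> half_sphere eta w ->
  dot (law_map f eta v) (law_map f eta w) =
  cos (f (ang v)) * cos (f (ang w)) +
  law_ratio v * law_ratio w * dot (proj_orth eta v) (proj_orth eta w).
Proof.
move=> hv hw; rewrite !law_mapE// /proj_orth !dotE eta1 !(dotC eta).
ring.
Qed.

Lemma law_map_half_sphere v : half_sphere eta v ->
  half_sphere eta (law_map f eta v).
Proof.
move=> hv; apply/half_sphereP; split.
  rewrite dot_law_map// -sin_ang_sqr// -!expr2 -exprMn law_ratioK//.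
  exact: cos2Dsin2.
have [fd _ _] := hf; have := fd _ (ang_dom hv).
rewrite dot_law_map_eta// /dom_law /= in_itv /= => /andP[f0 fpi].
by apply: cos_gt0_pihalf; have := pi_gt0 R; lra.
Qed.

Section Contraction.
Context (kap : R) (kap0 : 0 <= kap).
Context (hsin : forall t, dom_law t -> sin (f t) <= kap * sin t).
Context (hcos : forall s t, dom_law s -> dom_law t ->
    1 - cos (f t - f s) <= kap ^+ 2 * (1 - cos (t - s))).

Lemma law_ratio_bound v : half_sphere eta v -> 0 <= law_ratio v <= kap.
Proof.
move=> hv; have vd := ang_dom hv; have [fd _ _] := hf.
have s0 := sin_dom_ge0 vd; rewrite /law_ratio.
rewrite divr_ge0 ?sin_dom_ge0//=; last exact: fd.
have [->|sn] := eqVneq (sin (ang v)) 0; first by rewrite invr0 mulr0.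
by rewrite ler_pdivrMr ?hsin// lt_def sn.
Qed.

Lemma law_map_dist v w : half_sphere eta v -> half_sphere eta w ->
  enorm (law_map f eta v - law_map f eta w) <= kap * enorm (v - w).
Proof.
move=> hv hw; have sub_sqr x y : dot x x = 1 -> dot y y = 1 ->
    enorm (x - y) ^+ 2 = 2 * (1 - dot x y).
  by move=> x1 y1; rewrite sqr_enorm !dotE x1 y1 (dotC y x); ring.
have [v1 _] := (half_sphereP v).1 hv; have [w1 _] := (half_sphereP w).1 hw.
have [Cv1 _] := (half_sphereP _).1 (law_map_half_sphere hv).
have [Cw1 _] := (half_sphereP _).1 (law_map_half_sphere hw).
rewrite -ler_sqr ?nnegrE ?mulr_ge0 ?enorm_ge0// exprMn !sub_sqr//.
rewrite [leRHS]mulrCA ler_pM2l// dot_law_map//.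
have := hcos (ang_dom hw) (ang_dom hv); rewrite !cosB !cos_ang//.
have /andP[rv0 rv1] := law_ratio_bound hv.
have /andP[rw0 rw1] := law_ratio_bound hw.
rewrite -(law_ratioK hv) -(law_ratioK hw).
(* [hcos] settles the case of parallel tangential parts, where [g = S]. Cauchy-Schwarz gives
   [g <= S] in general, and the bounds on the ratios handle the surplus [S - g]. *)
set g := dot (proj_orth eta v) (proj_orth eta w).
set S := sin (ang v) * sin (ang w).
have gS : 0 <= S - g.
  have S0 : 0 <= S by apply: mulr_ge0; apply: sin_dom_ge0; exact: ang_dom.
  have := dot_sqr_le (proj_orth eta v) (proj_orth eta w).
  rewrite -!sin_ang_sqr// -exprMn -/g -/S subr_ge0.
  have [g0 _|g0] := leP g 0; first exact: le_trans S0.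
  by rewrite ler_sqr ?nnegrE ?(ltW g0).
have -> : dot v w = dot v eta * dot w eta + g.
  by rewrite /g dot_proj_orth; ring.
have : law_ratio v * law_ratio w * (S - g) <= kap ^+ 2 * (S - g).
  by rewrite ler_wpM2r// expr2 ler_pM.
rewrite /S; lra.
Qed.

Lemma law_map_cvg T (F : set_system T) {FF : Filter F} (g : T -> 'rV[R]_d) v :
  (\forall x \near F, half_sphere eta (g x)) -> half_sphere eta v ->
  g @ F --> v -> law_map f eta (g x) @[x --> F] --> law_map f eta v.
Proof.
move=> hg hv gv; apply: cvg_enorm0.
have h0 : kap * enorm (g x - v) @[x --> F] --> 0.
  rewrite -[X in _ --> X](mulr0 kap); apply: cvgM; first exact: cvg_cst.
  rewrite -[X in _ --> X](@enorm0 R d) -(subrr v); apply: cvg_enorm.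
  by apply: cvgB => //; exact: cvg_cst.
apply: (squeeze_cvgr _ (cvg_cst 0) h0); apply: filterS hg => x hx.
by rewrite enorm_ge0 law_map_dist.
Qed.

End Contraction.

End SphereLaw.

(** * Differentiability of the law along curves of velocities *)

Section Velocity.
Context {R : realType} {d : nat} (f : R -> R) (hf : contracting_law f).
Context (eta : 'rV[R]_d) (eta1 : dot eta eta = 1).
Implicit Types (g : R -> 'rV[R]_d) (v w : 'rV[R]_d).

Lemma is_derive_proj_orth g w : is_derive (0 : R) 1 g w ->
  is_derive (0 : R) 1 (fun s => proj_orth eta (g s)) (proj_orth eta w).
Proof.
move=> gw; have xd := is_derive_dot gw (is_derive_cst eta (0 : R) 1).
rewrite dot0r add0r in xd.
have xe := is_derive_scale xd (is_derive_cst eta (0 : R) 1).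
rewrite scaler0 add0r in xe.
exact: is_deriveB.
Qed.

Lemma dot_velocity g w : (\forall s \near (0 : R), dot (g s) (g s) = 1) ->
  is_derive (0 : R) 1 g w -> dot (g 0) w = 0.
Proof.
move=> g1 gw; have h := is_derive_dot gw gw.
have h' : is_derive (0 : R) 1 (fun s => dot (g s) (g s)) 0.
  refine (@near_eq_is_derive R R^o R^o (cst 1) _ 0 1 0 _ _).
  by apply: filterS g1 => s ->.
have := @derive_val _ _ _ _ _ _ _ h; rewrite (@derive_val _ _ _ _ _ _ _ h').
rewrite (dotC w); lra.
Qed.

Lemma law_ratio_cvg (f1 : R -> R) : is_derive_on (@dom_law R) f f1 ->
  sin (f y) / sin y @[y --> within (dom_law `\ (0 : R)) (nbhs (0 : R))] -->
  f1 0.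
Proof.
move=> df; have [_ f0 _] := hf.
have d0 : dom_law (0 : R).
  by rewrite /dom_law /= in_itv /= lexx divr_gt0 ?pi_gt0.
(* The odd extension of the law is differentiable at 0 in the usual sense. *)
pose F y := Num.sg y * f `|y|.
have F0 : F 0 = 0 by rewrite /F sgr0 mul0r.
have Fd : is_derive (0 : R) 1 F (f1 0).
  apply/(@is_derive0P R R^o); rewrite F0; apply/cvgrPdist_lt => e e0.
  move/cvgrPdist_lt : (df 0 d0) => /(_ e e0); rewrite near_withinE => h.
  have nc : `|y| @[y --> (0 : R)] --> (0 : R).
    by rewrite -[X in _ --> X](@normr0 R R); apply: cvg_norm; exact: cvg_id.
  move/nc : h => h; near=> y.
  have y0 : y != 0 by near: y; exact: nbhs_dnbhs_neq.
  have : (dom_law `\ (0 : R)) `|y| ->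
      `|f1 0 - (f `|y| - f 0) / (`|y| - 0)| < e.
    by near: y; apply: nbhs_dnbhs; exact: h.
  have -> : y^-1 *: (F y - 0) = f `|y| / `|y|.
    rewrite subr0 /GRing.scale /= /F; have [yn|yp|y00] := ltgtP y 0.
    - by rewrite ltr0_sg// ltr0_norm// invrN; ring.
    - by rewrite gtr0_sg// gtr0_norm//; ring.
    - by rewrite y00 eqxx in y0.
  rewrite f0 !subr0; apply; split.
    rewrite /dom_law /= in_itv /= normr_ge0 /=.
    by near: y; apply: dnbhs0_lt; rewrite divr_gt0 ?pi_gt0.
  by apply/eqP; rewrite normr_eq0.
have Sd : is_derive (0 : R) 1 (fun y => sin (F y)) (f1 0).
  apply: (is_derive_eq (is_derive1_comp (is_derive_sin (F 0)) Fd)).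
  by rewrite F0 cos0 mul1r.
move/(@is_derive0P R R^o) : Sd; rewrite F0 sin0 => Sq.
have sq : h^-1 *: (sin h - 0) @[h --> (0 : R)^'] --> (1 : R).
  have := (@is_derive0P R R^o (@sin R) (cos 0)).1 (is_derive_sin 0).
  by rewrite sin0 cos0.
have q : (h^-1 * sin (F h)) * (h^-1 * sin h)^-1 @[h --> (0 : R)^'] --> f1 0.
  rewrite -[X in _ --> X]mulr1 -(@invr1 R); apply: cvgM.
    by move: Sq; under eq_fun do rewrite subr0.
  by apply: cvgV; rewrite ?oner_neq0//; move: sq; under eq_fun do rewrite subr0.
apply/cvgrPdist_lt => e e0; move/cvgrPdist_lt : q => /(_ e e0).
rewrite !near_withinE; apply: filterS => y h [yd /eqP y0].
have := h y0; rewrite invfM invrK mulrACA mulVf// mul1r.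
rewrite /F; have : 0 < y.
  by move: yd; rewrite /dom_law /= in_itv /= => /andP[+ _]; rewrite lt_def y0.
by move=> yp; rewrite gtr0_sg// gtr0_norm// mul1r.
Unshelve. all: by end_near. Qed.

(** Off the normal direction the angle lies strictly between 0 and [pi / 2], where arccosine, [f]
    and the reciprocal of sine can all be differentiated. *)
Lemma law_map_derivable_generic g w :
  (\forall s \near (0 : R), half_sphere eta (g s)) -> dot (g 0) eta < 1 ->
  is_derive (0 : R) 1 g w ->
  exists w', is_derive (0 : R) 1 (fun s => law_map f eta (g s)) w'.
Proof.
move=> hg g01 gw; have hg0 := nbhs_singleton hg.
have [_ [_ [_ [f1 [df _]]]]] := law_sup hf.
pose x s := dot (g s) eta; pose t s := acos (x s).
have [x' xd] : exists x', is_derive (0 : R) 1 x x'.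
  by eexists; exact: is_derive_dot gw (is_derive_cst eta (0 : R) 1).
have [t' td] : exists t', is_derive (0 : R) 1 t t'.
  eexists; apply: (@is_derive1_comp _ (@acos R) x); apply: is_derive1_acos.
  by rewrite g01 andbT (lt_trans (ltrN10 R))//; case: hg0.
have t0 : 0 < t 0 < pi / 2.
  have := ang_dom eta1 hg0; rewrite /dom_law /= in_itv /= => /andP[t0 ->].
  rewrite andbT lt_def t0 andbT; apply: contraTneq g01 => h.
  by rewrite -(cos_ang eta1 hg0) -/(x 0) -/(t 0) h cos0 ltxx.
have [y' yd] : exists y', is_derive (0 : R) 1 (fun s => f (t s)) y'.
  by eexists; exact: (is_derive1_comp (law_derive df t0) td).
have [A' Ad] : exists A', is_derive (0 : R) 1 (fun s => cos (f (t s))) A'.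
  by eexists; exact: (@is_derive1_comp _ (@cos R) (fun s => f (t s))).
have [B' Bd] : exists B', is_derive (0 : R) 1 (fun s => sin (f (t s))) B'.
  by eexists; exact: (@is_derive1_comp _ (@sin R) (fun s => f (t s))).
have [C' Cd] : exists C', is_derive (0 : R) 1 (fun s => sin (t s)) C'.
  by eexists; exact: (@is_derive1_comp _ (@sin R) t).
have C0 : sin (t 0) != 0 by rewrite gt_eqF// sin_gt0_pihalf.
have Vd := @is_deriveV R (fun s => sin (t s)) 0 C' 1 C0 Cd.
have BVd := is_deriveM Bd Vd.
have Ed := is_derive_scale BVd (is_derive_proj_orth gw).
have Fd := is_deriveD (is_derive_scale Ad (is_derive_cst eta (0 : R) 1)) Ed.
eexists; refine (near_eq_is_derive _ Fd).
by apply: filterS hg => s hs; rewrite /= law_mapE.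
Qed.

(* At the normal direction the angle is not differentiable along the curve; the
   normal component of the image is controlled by that of the curve, which has
   a maximum there, and the ratio of the sines tends to the derivative of the
   law. *)
Lemma law_map_derivable_normal g w :
  (\forall s \near (0 : R), half_sphere eta (g s)) -> g 0 = eta ->
  is_derive (0 : R) 1 g w ->
  exists w', is_derive (0 : R) 1 (fun s => law_map f eta (g s)) w'.
Proof.
move=> hg g0 gw; have hg0 := nbhs_singleton hg.
have [_ [_ [_ [f1 [df _]]]]] := law_sup hf.
have [K K0 hcos] : exists2 K : R, 0 <= K & forall s t, dom_law s ->
    dom_law t -> 1 - cos (f t - f s) <= K * (1 - cos (t - s)).
  have [kap [_ _ _ h]] := law_contraction hf.
  by exists (kap ^+ 2); rewrite ?sqr_ge0.
have [fd f0 _] := hf.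
have d0 : dom_law (0 : R).
  by rewrite /dom_law /= in_itv /= lexx divr_gt0 ?pi_gt0.
pose t s := acos (dot (g s) eta).
have t0 : t 0 = 0 by rewrite /t g0 eta1 acos1.
have tdom : \forall s \near (0 : R), dom_law (t s).
  by apply: filterS hg => s; exact: ang_dom.
have xd := is_derive_dot gw (is_derive_cst eta (0 : R) 1).
have w0 : dot w eta = 0.
  rewrite dotC -g0; apply: dot_velocity gw.
  by apply: filterS hg => s /half_sphereP[].
rewrite dot0r add0r w0 in xd.
have tc : t s @[s --> (0 : R)] --> 0.
  apply/cvgrPdist_lt => e e0.
  pose m := Num.min e (pi / 2).
  have m0 : 0 < m by rewrite lt_min e0 divr_gt0 ?pi_gt0.
  have mpi : m <= pi / 2 by rewrite ge_min lexx orbT.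
  have cm : cos m < dot (g 0) eta.
    rewrite g0 eta1 -(@cos0 R) ltr_cos// in_itv /=; have := pi_gt0 R; lra.
  have xc : dot (g s) eta @[s --> (0 : R)] --> dot (g 0) eta.
    by apply: cvg_dot; [exact: is_derive1_cvg gw|exact: cvg_cst].
  have xn : \forall s \near (0 : R), cos m < dot (g s) eta.
    exact: cvgr_gt xc _ cm.
  apply: filterS2 hg xn => s hs.
  rewrite -(cos_ang eta1 hs) -/(t s).
  have := ang_dom eta1 hs; rewrite -/(t s) /dom_law /= in_itv /=.
  move=> /andP[ts0 tspi]; rewrite ltr_cos ?in_itv /=; last 2 first.
    by have := pi_gt0 R; lra.
    by have := pi_gt0 R; lra.
  by rewrite sub0r normrN ger0_norm// lt_min => /andP[].
(* [1 - cos (f t)] is at most [K * (1 - cos t)], and [cos t] is the normal component of the curve,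
   whose derivative vanishes at this maximum. *)
have Ad : is_derive (0 : R) 1 (fun s => cos (f (t s))) 0.
  apply/(@is_derive0P R R^o).
  move/(@is_derive0P R R^o) : xd => xq.
  have xq0 : K * `|h^-1 *: (dot (g h) eta - dot (g 0) eta)|
      @[h --> (0 : R)^'] --> 0.
    rewrite -[X in _ --> X](mulr0 K); apply: cvgM; first exact: cvg_cst.
    by rewrite -[X in _ --> X](@normr0 R R); exact: cvg_norm xq.
  apply/cvgr0Pnorm_le => e e0; move/cvgr0Pnorm_le : xq0 => /(_ e e0) xq0.
  near=> h.
  have hh : half_sphere eta (g h) by near: h; exact: nbhs_dnbhs hg.
  have : `|K * `|h^-1 *: (dot (g h) eta - dot (g 0) eta)| | <= e by near: h.
  apply: le_trans; rewrite t0 f0 cos0 g0 eta1 /GRing.scale /=.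
  rewrite !normrM !normr_id (ger0_norm K0) [leRHS]mulrCA.
  rewrite ler_wpM2l//.
  rewrite [leLHS]distrC [X in _ <= _ * X]distrC.
  have := hcos _ _ d0 (ang_dom eta1 hh); rewrite f0 !subr0 cos_ang// => hc.
  rewrite ger0_norm ?subr_ge0 ?cos_le1// ger0_norm// subr_ge0.
  by have /andP[] := dot_half_sphere eta1 hh.
(* Unlike [law_ratio], which is 0 at the normal by convention, [rho] is continuous there; both give
   the same map since the tangential part vanishes. *)
pose rho s := if t s == 0 then f1 0 else law_ratio f eta (g s).
have rc : rho s @[s --> (0 : R)] --> f1 0.
  apply/cvgrPdist_lt => e e0.
  have /cvgrPdist_lt/(_ e e0) := law_ratio_cvg df.
  rewrite near_withinE => /tc hn; apply: filterS2 tdom hn => s.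
  rewrite /rho /law_ratio -/(t s) /= => td; case: eqVneq => [_ _|/eqP tn].
    by rewrite subrr normr0.
  by apply; split.
have pd := is_derive_proj_orth gw.
have p0 : proj_orth eta (g 0) = 0.
  by rewrite /proj_orth g0 eta1 scale1r subrr.
(* A factor that is merely continuous at 0 suffices, because the differentiable curve that it
   multiplies vanishes at 0. *)
have Ed : is_derive (0 : R) 1 (fun s => rho s *: proj_orth eta (g s))
    (f1 0 *: proj_orth eta w).
  apply/is_derive0P; move/is_derive0P : pd; rewrite p0 scaler0 => pq.
  have -> : (fun h : R => h^-1 *: (rho h *: proj_orth eta (g h) - 0)) =
      (fun h : R => rho h *: (h^-1 *: (proj_orth eta (g h) - 0))).
    by apply/funext => h; rewrite !subr0 !scalerA mulrC.
  by apply: cvgZ pq; apply: cvg_within_filter; exact: rc.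
have Fd := is_deriveD (is_derive_scale Ad (is_derive_cst eta (0 : R) 1)) Ed.
eexists; refine (near_eq_is_derive _ Fd).
apply: filterS hg => s hs; rewrite /= law_mapE// -/(t s); congr (_ + _).
rewrite /rho; case: eqVneq => // ts0.
have /eqP := sin_ang_sqr eta1 hs; rewrite -/(t s) ts0 sin0 expr0n eq_sym.
by rewrite dot_eq0 => /eqP ->; rewrite !scaler0.
Unshelve. all: by end_near. Qed.

(** Once the derivative exists, the chordal Lipschitz bound passes to the limit of the difference
    quotients. *)
Lemma law_map_velocity (kap : R) g w : 0 <= kap ->
  (forall t, dom_law t -> sin (f t) <= kap * sin t) ->
  (forall s t, dom_law s -> dom_law t ->
    1 - cos (f t - f s) <= kap ^+ 2 * (1 - cos (t - s))) ->
  (\forall s \near (0 : R), half_sphere eta (g s)) ->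
  is_derive (0 : R) 1 g w ->
  exists w', is_derive (0 : R) 1 (fun s => law_map f eta (g s)) w' /\
             enorm w' <= kap * enorm w.
Proof.
move=> kap0 hsin hcos hg gw; have hg0 := nbhs_singleton hg.
have [w' gw'] : exists w',
    is_derive (0 : R) 1 (fun s => law_map f eta (g s)) w'.
  have /andP[_] := dot_half_sphere eta1 hg0; rewrite le_eqVlt.
  move=> /predU1P[g01|g01]; last exact: law_map_derivable_generic gw.
  apply: law_map_derivable_normal gw => //.
  have [g1 _] := (half_sphereP eta (g 0)).1 hg0.
  apply/eqP; rewrite -subr_eq0 -dot_eq0 !dotE g1 eta1 (dotC eta) g01.
  by apply/eqP; ring.
exists w'; split=> //.
move/is_derive0P : gw => gw; move/is_derive0P : gw' => gw'.
have c : kap * enorm (h^-1 *: (g h - g 0)) @[h --> (0 : R)^'] --> kap * enorm w.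
  by apply: cvgM; [exact: cvg_cst|exact: cvg_enorm].
apply: (ler_cvg_to (cvg_enorm gw') c); near=> h.
rewrite !enormZ mulrCA ler_wpM2l//; apply: (law_map_dist hf eta1) => //.
by near: h; exact: nbhs_dnbhs hg.
Unshelve. all: by end_near. Qed.

End Velocity.

(** * The differential along an orbit *)

Section TangentDynamics.
Context {R : realType} {d : nat} (f : R -> R) (P : set 'rV[R]_d) (I : finType).
Context (eta : I -> 'rV[R]_d) (c : I -> R) (irrP : irredundant P eta c).
Context (cP : compact P) (hf : contracting_law f).
Implicit Types (p v e u w : 'rV[R]_d) (i j l : I) (x : phase R d).
Implicit Types g : R -> phase R d.

Local Notation on_wall := (on_wall eta c).
Local Notation wall_time := (wall_time eta c).
Local Notation hits := (hits eta c).
Local Notation collide := (collide f eta c).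

Lemma cvg_wall_time T (F : set_system T) {FF : Filter F} (h : T -> phase R d)
    j x : h @ F --> x -> dot (eta j) x.2 != 0 ->
  wall_time j (h t) @[t --> F] --> wall_time j x.
Proof.
move=> hx xj; have h1 : (h t).1 @[t --> F] --> x.1.
  exact: (cvg_comp h _ hx (@cvg_fst _ _ _ _ _)).
have h2 : (h t).2 @[t --> F] --> x.2.
  exact: (cvg_comp h _ hx (@cvg_snd _ _ _ _ _)).
apply: cvgM.
  apply: cvgB; last exact: cvg_cst.
  by apply: cvg_dot => //; exact: cvg_cst.
apply: cvgV; first by rewrite oppr_eq0.
by apply: cvgN; apply: cvg_dot => //; exact: cvg_cst.
Qed.

Lemma near_on_facet T (F : set_system T) {FF : Filter F} (h : T -> 'rV[R]_d)
    p (A : pred I) : h @ F --> p ->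
  (forall l, A l -> c l < dot (eta l) p) ->
  \forall t \near F, forall l, A l -> c l < dot (eta l) (h t).
Proof.
move=> hp pl.
apply: (@filter_forall _ _ (fun l t => A l -> c l < dot (eta l) (h t))) => l.
have [Al|_] := boolP (A l); last by near=> t.
have hl : dot (eta l) (h t) @[t --> F] --> dot (eta l) p.
  by apply: cvg_dot => //; exact: cvg_cst.
have hg : \forall t \near F, c l < dot (eta l) (h t).
  exact: cvgr_gt hl _ (pl l Al).
exact: filterS hg.
Unshelve. all: by end_near. Qed.

Lemma near_hits T (F : set_system T) {FF : Filter F} (h : T -> phase R d) j x :
  h @ F --> x -> hits j x -> \forall t \near F, hits j (h t).
Proof.
move=> hx [xj xl].
have h1 : (h t).1 @[t --> F] --> x.1.
  exact: (cvg_comp h _ hx (@cvg_fst _ _ _ _ _)).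
have h2 : (h t).2 @[t --> F] --> x.2.
  exact: (cvg_comp h _ hx (@cvg_snd _ _ _ _ _)).
have hj : dot (eta j) (h t).2 @[t --> F] --> dot (eta j) x.2.
  by apply: cvg_dot => //; exact: cvg_cst.
have n1 : \forall t \near F, dot (eta j) (h t).2 < 0 by exact: cvgr_lt hj _ xj.
have hq : (h t).1 + wall_time j (h t) *: (h t).2 @[t --> F] -->
    x.1 + wall_time j x *: x.2.
  apply: cvgD => //; apply: cvgZ => //; apply: cvg_wall_time => //.
  by rewrite lt_eqF.
have n2 := near_on_facet (FF := FF) (A := fun l => l != j) hq xl.
by apply: filterS2 n1 n2 => t ht1 ht2; split.
Qed.

Lemma reflection_half_sphere e v : dot e e = 1 -> enorm v = 1 ->
  dot e v < 0 -> half_sphere e (reflection e v).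
Proof.
move=> e1 v1 ev; have vv : dot v v = 1 by rewrite -sqr_enorm v1 expr1n.
apply/half_sphereP; rewrite /reflection !dotE (dotC v e) e1 vv.
split; first ring.
by rewrite mulr1; lra.
Qed.

Lemma collide_on_wall i j x : on_wall i x -> hits j x ->
  on_wall j (collide j x).
Proof.
move=> [_ x1 _] hj; have e1 := eta_unit irrP j.
have := law_map_half_sphere hf e1 (reflection_half_sphere e1 x1 hj.1).
move=> [C1 C0]; split=> //; first exact: hits_on_facet hj.
by rewrite dotC.
Qed.

Lemma curve0 i x (w : phase R d) : on_wall i x -> curve x w 0 = x.
Proof.
move=> [_ x1 _]; rewrite /curve !scale0r !addr0 x1 invr1 scale1r.
by case: x x1.
Qed.

Lemma on_wall_velocity i g u :
  (\forall s \near (0 : R), on_wall i (g s)) ->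
  is_derive (0 : R) 1 (fun s => (g s).1) u -> dot (eta i) u = 0.
Proof.
move=> hg gu; have h := is_derive_dot (is_derive_cst (eta i) (0 : R) 1) gu.
rewrite dot0l addr0 in h.
have h' : is_derive (0 : R) 1 (fun s => dot (eta i) (g s).1) 0.
  refine (@near_eq_is_derive R R^o R^o (cst (c i)) _ 0 1 0 _ _).
  by apply: filterS hg => s [[->]].
by rewrite -(@derive_val _ _ _ _ _ _ _ h) (@derive_val _ _ _ _ _ _ _ h').
Qed.

Lemma derive1_pair g u w :
  is_derive (0 : R) 1 (fun s => (g s).1) u ->
  is_derive (0 : R) 1 (fun s => (g s).2) w -> derive1 g 0 = (u, w).
Proof.
move=> /is_derive0P gu /is_derive0P gw; apply: cvg_lim => //.
have -> : (fun h : R => h^-1 *: (g (h + 0) - g 0)) = (fun h : R =>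
    (h^-1 *: ((g h).1 - (g 0).1), h^-1 *: ((g h).2 - (g 0).2))).
  by apply/funext => h; rewrite addr0.
exact: cvg_pair gu gw.
Qed.

Lemma cvg_curve g u w :
  is_derive (0 : R) 1 (fun s => (g s).1) u ->
  is_derive (0 : R) 1 (fun s => (g s).2) w -> g s @[s --> (0 : R)] --> g 0.
Proof.
move=> /is_derive1_cvg gu /is_derive1_cvg gw.
rewrite [X in _ --> X]surjective_pairing.
have -> : g = fun s => ((g s).1, (g s).2).
  by apply/funext => s; rewrite -surjective_pairing.
exact: cvg_pair gu gw.
Qed.

Section Step.
Context (kap : R) (kap0 : 0 <= kap).
Context (hsin : forall t, dom_law t -> sin (f t) <= kap * sin t).
Context (hcos : forall s t, dom_law s -> dom_law t ->
    1 - cos (f t - f s) <= kap ^+ 2 * (1 - cos (t - s))).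

(** [hits j] being open, nearby points of the curve also collide with wall [j], so [Phi] is
    [collide j] along the curve. The number [a] is the derivative of the collision time; nothing is
    claimed about its size. *)
Lemma curve_step i j g u w :
  (\forall s \near (0 : R), on_wall i (g s)) -> hits j (g 0) ->
  is_derive (0 : R) 1 (fun s => (g s).1) u ->
  is_derive (0 : R) 1 (fun s => (g s).2) w ->
  exists u' w', [/\ \forall s \near (0 : R), on_wall j (Phi f P (g s)),
    is_derive (0 : R) 1 (fun s => (Phi f P (g s)).1) u',
    is_derive (0 : R) 1 (fun s => (Phi f P (g s)).2) w',
    exists a, u' = u + wall_time j (g 0) *: w + a *: (g 0).2 &
    enorm w' <= kap * enorm w].
Proof.
move=> hg hj gu gw; have gc := cvg_curve gu gw.
have nj := near_hits (FF := nbhs_filter (0 : R)) gc hj.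
have g0 := nbhs_singleton hg.
have nP : \forall s \near (0 : R), collide j (g s) = Phi f P (g s).
  by apply: filterS2 hg nj => s gi gj; rewrite (Phi_collide f irrP gi gj).
have e1 := eta_unit irrP j.
have cd v : is_derive (0 : R) 1 (cst v : R -> 'rV[R]_d) 0.
  exact: is_derive_cst.
have refl_d : is_derive (0 : R) 1 (fun s => reflection (eta j) (g s).2)
    (w - (2 * dot w (eta j)) *: eta j).
  have xd := is_derive_dot gw (cd (eta j)); rewrite dot0r add0r in xd.
  have x2 : is_derive (0 : R) 1 (fun s => 2 * dot (g s).2 (eta j))
      (2 * dot w (eta j)).
    by apply: (is_derive_eq (is_deriveZ 2 xd)).
  have := is_derive_scale x2 (cd (eta j)); rewrite scaler0 add0r => x3.
  exact: is_deriveB.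
have refl_hs : \forall s \near (0 : R),
    half_sphere (eta j) (reflection (eta j) (g s).2).
  by apply: filterS2 hg nj => s [_ g1 _] [gj _]; exact: reflection_half_sphere.
have [w' [wd wle]] := law_map_velocity hf e1 kap0 hsin hcos refl_hs refl_d.
have [t' td] : exists t', is_derive (0 : R) 1 (fun s => wall_time j (g s)) t'.
  have nd := is_derive_dot (cd (eta j)) gu.
  have dd := is_derive_dot (cd (eta j)) gw.
  have n2 := is_deriveB nd (is_derive_cst (c j) (0 : R) 1).
  have d2 := is_deriveN dd.
  have d0 : - dot (eta j) (g 0).2 != 0 by rewrite oppr_eq0 lt_eqF//; case: hj.
  have d3 := @is_deriveV R (fun s => - dot (eta j) (g s).2) 0 _ 1 d0 d2.
  by eexists; exact: is_deriveM n2 d3.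
have qd := is_deriveD gu (is_derive_scale td gw).
exists (u + (wall_time j (g 0) *: w + t' *: (g 0).2)), w'; split.
- apply: filterS3 hg nj nP => s gi gj <-; exact: collide_on_wall gi gj.
- refine (near_eq_is_derive _ qd); apply: filterS nP => s <- //.
- refine (near_eq_is_derive _ wd); apply: filterS nP => s <- //.
- by exists t'; rewrite addrA.
- apply: le_trans wle _; apply: ler_wpM2l => //.
  rewrite -ler_sqr ?nnegrE ?enorm_ge0// !sqr_enorm !dotE e1 (dotC (eta j)).
  by rewrite le_eqVlt; apply/orP; left; apply/eqP; ring.
Qed.

(** [w.2] is orthogonal to the unit vector [x.2], so the normalising factor has derivative 0 and
    does not alter the velocity. *)
Lemma curve_start i x (w : phase R d) : on_wall i x -> tangent P x w ->
  [/\ \forall s \near (0 : R), on_wall i (curve x w s),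
    is_derive (0 : R) 1 (fun s => (curve x w s).1) w.1 &
    is_derive (0 : R) 1 (fun s => (curve x w s).2) w.2].
Proof.
move=> xi [wi wv]; have [[xi1 xi2] x1 xi3] := xi.
rewrite (normal_at_facet irrP (conj xi1 xi2)) dotC in wi.
have line p v : is_derive (0 : R) 1 (fun s => p + s *: v) v.
  have := is_derive_scale (is_derive_id (0 : R) 1) (is_derive_cst v (0 : R) 1).
  rewrite scaler0 add0r scale1r => h.
  have := is_deriveD (is_derive_cst p (0 : R) 1) h; rewrite add0r; exact.
have l1 := line x.1 w.1; have l2 := line x.2 w.2.
have n0 : dot x.2 x.2 = 1 by rewrite -sqr_enorm x1 expr1n.
pose n s := enorm (x.2 + s *: w.2).
have n01 : n 0 = 1 by rewrite /n scale0r addr0 x1.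
have nd : is_derive (0 : R) 1 n 0.
  have h := is_derive_dot l2 l2.
  rewrite scale0r addr0 wv dotC wv addr0 in h.
  have s1 : is_derive (dot (x.2 + 0 *: w.2) (x.2 + 0 *: w.2)) 1 (@Num.sqrt R)
      (2 * Num.sqrt (dot (x.2 + 0 *: w.2) (x.2 + 0 *: w.2)))^-1.
    by apply: is_derive1_sqrt; rewrite scale0r addr0 n0.
  by have := is_derive1_comp s1 h; rewrite mulr0.
have nVd : is_derive (0 : R) 1 (fun s => (n s)^-1) 0.
  have n0' : n 0 != 0 by rewrite n01 oner_eq0.
  have h := @is_deriveV R n 0 _ 1 n0' nd; rewrite scaler0 in h; exact: h.
have vd : is_derive (0 : R) 1 (fun s => (curve x w s).2) w.2.
  have := is_derive_scale nVd l2; rewrite n01 invr1 scale1r scale0r addr0.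
  exact.
split=> //.
have c1 : x.1 + s *: w.1 @[s --> (0 : R)] --> x.1.
  by have := is_derive1_cvg l1; rewrite scale0r addr0.
have nf := near_on_facet (FF := nbhs_filter (0 : R)) (A := fun l => l != i)
  c1 xi2.
have nn : \forall s \near (0 : R), 0 < n s.
  have nc : n s @[s --> (0 : R)] --> (1 : R).
    rewrite -x1; apply: cvg_enorm.
    by have := is_derive1_cvg l2; rewrite scale0r addr0.
  exact: cvgr_gt nc _ ltr01.
have ni : \forall s \near (0 : R), 0 < dot (eta i) (curve x w s).2.
  have vc := is_derive1_cvg vd; rewrite (curve0 w xi) in vc.
  have dc : dot (eta i) (curve x w s).2 @[s --> (0 : R)] --> dot (eta i) x.2.
    by apply: cvg_dot => //; exact: cvg_cst.
  exact: cvgr_gt dc _ xi3.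
apply: filterS3 nf nn ni => s sf sn si; split=> //.
  by split=> //=; rewrite dotDr dotZr wi mulr0 addr0.
by rewrite /= enormZ gtr0_norm ?invr_gt0// mulVf// gt_eqF.
Qed.

(** Induction on collisions. It also certifies that [DPhi], a limit with a default value, is here a
    true derivative. *)
Lemma curve_iter x (w : phase R d) n : Mplus f P x -> tangent P x w ->
  exists i, [/\ \forall s \near (0 : R),
      on_wall i (iter n (Phi f P) (curve x w s)),
    is_derive (0 : R) 1 (fun s => (iter n (Phi f P) (curve x w s)).1)
      (DPhi f P n x w).1 &
    is_derive (0 : R) 1 (fun s => (iter n (Phi f P) (curve x w s)).2)
      (DPhi f P n x w).2].
Proof.
move=> [_ xM] xw; have [i [j [xi _]]] := M'_hits irrP cP (xM 0%N).
elim: n => [|n [k [nk dk1 dk2]]].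
  have [h1 h2 h3] := curve_start xi xw; exists i.
  by rewrite /DPhi
    (derive1_pair (g := fun s => iter 0 (Phi f P) (curve x w s)) h2 h3).
have [k' [j' [xk' xj']]] := M'_hits irrP cP (xM n).
have nj : hits j' (iter n (Phi f P) (curve x w 0)) by rewrite (curve0 w xi).
have [u' [w' [h1 h2 h3 _ _]]] := curve_step nk nj dk1 dk2.
exists j'; rewrite /DPhi.
by rewrite
  (derive1_pair (g := fun s => iter n.+1 (Phi f P) (curve x w s)) h2 h3).
Qed.

Lemma tangent_recurrence : exists L, 0 <= L /\
  forall x (w : phase R d), Mplus f P x -> tangent P x w -> forall n,
  let v k := (iter k (Phi f P) x).2 in
  let e k := normal_at P (iter k (Phi f P) x).1 in
  let u k := (DPhi f P k x w).1 in let o k := (DPhi f P k x w).2 in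
  [/\ exists i, e n = eta i, dot (e n) (u n) = 0,
      dot (v n) (v n) = 1, dot (v n) (o n) = 0 &
      [/\ exists t a, [/\ 0 <= t, t <= L & u n.+1 = u n + t *: o n + a *: v n],
       enorm (o n.+1) <= kap * enorm (o n) &
       exists r, [/\ 0 <= r, r <= kap & forall z, dot (e n.+1) z = 0 ->
         dot z (v n.+1) = r * dot z (v n)]]].
Proof.
have [L hL] := polytope_bounded cP.
(* Velocities are unit vectors, so a flight time is the distance between two points of [P]; the
   maximum with 0 supplies the sign. *)
exists (Num.max 0 (L + L)); split; first by rewrite le_max lexx.
move=> x w xM xw n v e u o.
have [i [nw d1 d2]] := curve_iter n xM xw.
have [i0 [j0 [xi0 _]]] := M'_hits irrP cP (xM.2 0%N).
have c0 : curve x w 0 = x := curve0 w xi0.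
have [i1 [j [xi xj]]] := M'_hits irrP cP (xM.2 n).
have wi := nbhs_singleton nw; rewrite c0 in wi.
have [wi1 v1 _] := wi.
have v1' : dot (v n) (v n) = 1 by rewrite -sqr_enorm v1 expr1n.
split=> //.
- by exists i; rewrite /e (normal_at_facet irrP wi1).
- by rewrite /e (normal_at_facet irrP wi1); exact: on_wall_velocity nw d1.
- have := dot_velocity _ d2; rewrite c0; apply.
  by apply: filterS nw => s [_ s1 _]; rewrite -sqr_enorm s1 expr1n.
have nj : hits j (iter n (Phi f P) (curve x w 0)) by rewrite c0.
have [u' [w' [h1 h2 h3 [a ua] wle]]] := curve_step nw nj d1 d2.
have D1 : DPhi f P n.+1 x w = (u', w').
  exact: (derive1_pair (g := fun s => iter n.+1 (Phi f P) (curve x w s)) h2 h3).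
have wj := collide_on_wall xi xj.
rewrite /u /o D1 /=; rewrite c0 in ua; split=> //.
  exists (wall_time j (iter n (Phi f P) x)), a; split=> //.
    by rewrite ltW// (wall_time_gt0 xi)//; case: xj.
  rewrite le_max; apply/orP; right.
  have T0 := wall_time_gt0 xi xj.1.
  have Px : P (iter n (Phi f P) x).1 by case: xi => /(on_facet_in irrP).
  have Pq := on_facet_in irrP (hits_on_facet xj).
  rewrite -[leLHS]ger0_norm ?(ltW T0)// -[leLHS]mulr1 -v1 -enormZ.
  apply: le_trans (lerD (hL _ Pq) (hL _ Px)).
  by apply: le_trans (ler_enormB _ _); rewrite addrAC subrr add0r.
have e1 := eta_unit irrP j.
have hs := reflection_half_sphere e1 v1 xj.1.
have Pn : iter n.+1 (Phi f P) x = collide j (iter n (Phi f P) x).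
  exact: (Phi_collide f irrP xi xj).
(* A vector tangent to the wall has the same scalar product with a velocity and with its reflection,
   so only the tangential factor of the law remains. *)
exists (law_ratio f (eta j) (reflection (eta j) (v n))).
have /andP[r0 r1] := law_ratio_bound hf e1 kap0 hsin hs.
split=> // z; rewrite /e /v Pn; have [wj1 _ _] := wj.
rewrite (normal_at_facet irrP wj1) => ez.
rewrite /= dot_law_map_orth//; congr (_ * _).
by rewrite /reflection dotBr dotZr (dotC z (eta j)) ez mulr0 subr0.
Qed.

End Step.
End TangentDynamics.

(** * Growth of tangent vectors *)

Section SpanningBound.
Context {R : realType} {d : nat}.
Implicit Types (u z : 'rV[R]_d).

Lemma enorm_delta (i : 'I_d) : enorm (delta_mx 0 i : 'rV[R]_d) = 1.
Proof.
apply/eqP; rewrite enorm_eq1 /dot (bigD1 i)//= !mxE !eqxx mulr1 big1 ?addr0//.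
by move=> j ji; rewrite !mxE (negbTE ji) andbF mul0r.
Qed.

Lemma enorm_le_sum z : enorm z <= \sum_i `|z 0 i|.
Proof.
rewrite [in leLHS](row_sum_delta z).
elim/big_rec2: _ => [|i x y _ h]; first by rewrite enorm0.
apply: le_trans (ler_enormD _ _) _; rewrite enormZ enorm_delta mulr1.
by rewrite lerD2l.
Qed.

(** The pseudo-inverse recovers [z] from its scalar products with the rows; the constant is the sum
    of the absolute values of its entries. *)
Lemma row_full_bound k (A : 'M[R]_(k, d)) : exists C, 0 <= C /\
  (row_full A -> forall z m, (forall j, `|dot (row j A) z| <= m) ->
    enorm z <= C * m).
Proof.
pose B := pinvmx A.
exists (\sum_i \sum_j `|B i j|); split.
  by apply: sumr_ge0 => i _; apply: sumr_ge0.
move=> fA z m hz; apply: le_trans (enorm_le_sum z) _.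
rewrite mulr_suml; apply: ler_sum => i _.
have -> : z 0 i = \sum_j B i j * dot (row j A) z.
  have : (B *m A *m z^T) i 0 = z 0 i.
    by rewrite mulVpmx// mul1mx mxE.
  rewrite -mulmxA mxE => <-; apply: eq_bigr => j _; congr (_ * _).
  by rewrite mxE; apply: eq_bigr => l _; rewrite !mxE.
rewrite mulr_suml; apply: le_trans (ler_norm_sum _ _ _) _.
by apply: ler_sum => j _; rewrite normrM ler_wpM2l.
Qed.

(** There are finitely many [k]-tuples of normals, so their constants can be summed; the resulting
    bound is uniform along an orbit. *)
Lemma spanning_bound (I : finType) (eta : I -> 'rV[R]_d) k : exists C, 0 <= C /\
  forall s : 'I_k -> I, row_full (\matrix_j eta (s j)) ->
  forall z m, 0 <= m -> (forall j, `|dot (eta (s j)) z| <= m) ->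
    enorm z <= C * m.
Proof.
have [C hC] := choice (fun s : {ffun 'I_k -> I} =>
  row_full_bound (\matrix_j eta (s j))).
exists (\sum_s C s); split; first by apply: sumr_ge0 => s _; have [] := hC s.
move=> s fs z m m0 hz; pose s' := [ffun j => s j].
have E : \matrix_j eta (s' j) = \matrix_j eta (s j).
  by apply/row_matrixP => j; rewrite !rowK ffunE.
have [_] := hC s'; rewrite E => /(_ fs z m) h.
apply: (le_trans (h _)); first by move=> j; rewrite rowK.
rewrite ler_wpM2r// (bigD1 s')//= lerDl sumr_ge0// => t _.
by have [] := hC t.
Qed.

End SpanningBound.

(** * Growth dichotomy for the abstract recurrence *)

Section Cocycle.
Context {R : realType} {d : nat} (kap L : R).
Context (kap0 : 0 <= kap) (kap1 : kap < 1) (L0 : 0 <= L).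
Context (v e u o : nat -> 'rV[R]_d).
Context (ee : forall n, dot (e n) (e n) = 1).
Context (eu : forall n, dot (e n) (u n) = 0).
Context (vv : forall n, dot (v n) (v n) = 1).
Context (vo : forall n, dot (v n) (o n) = 0).
Context (u_step : forall n, exists t a,
  [/\ 0 <= t, t <= L & u n.+1 = u n + t *: o n + a *: v n]).
Context (o_step : forall n, enorm (o n.+1) <= kap * enorm (o n)).
Context (v_step : forall n, exists r, [/\ 0 <= r, r <= kap &
  forall z, dot (e n.+1) z = 0 -> dot z (v n.+1) = r * dot z (v n)]).

Lemma o_decay n : enorm (o n) <= kap ^+ n * enorm (o 0%N).
Proof.
elim: n => [|n IH]; first by rewrite expr0 mul1r.
apply: le_trans (o_step n) _; rewrite exprS -mulrA.
exact: ler_wpM2l.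
Qed.

(* The part of [u n] normal to the velocity: a free flight changes its length by
   at most [err n], and a collision never decreases it. *)
Definition shadow n : R := enorm (proj_orth (v n) (u n)).
Definition slant n : R := dot (u n.+1) (v n).
Definition err n : R := L * (kap ^+ n * enorm (o 0%N)).
(* The sum of [err m] over all [m >= n]. *)
Definition drift n : R := L * (kap ^+ n * enorm (o 0%N)) / (1 - kap).

Lemma err_ge0 n : 0 <= err n.
Proof. by rewrite mulr_ge0// mulr_ge0 ?exprn_ge0 ?enorm_ge0. Qed.

Lemma driftS n : drift n = err n + drift n.+1.
Proof. by rewrite /drift /err exprS; field; rewrite subr_eq0 gt_eqF. Qed.

Lemma drift_ge0 n : 0 <= drift n.
Proof. by rewrite divr_ge0 ?err_ge0// subr_ge0 ltW. Qed.

Lemma drift_le n m : (n <= m)%N -> drift m <= drift n.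
Proof.
move=> /subnK <-; elim: (m - n)%N => [|k]; first by rewrite add0n.
by apply: le_trans; rewrite addSn (driftS (k + n)) lerDr err_ge0.
Qed.

Lemma shadow_ge0 n : 0 <= shadow n.
Proof. exact: enorm_ge0. Qed.

Lemma sqr_enorm_proj_orth n z :
  enorm z ^+ 2 = enorm (proj_orth (v n) z) ^+ 2 + dot z (v n) ^+ 2.
Proof. by rewrite !sqr_enorm dot_proj_orth//; ring. Qed.

(** Pairing with [v n] kills [o n] and expresses [a], on which the recurrence gives no bound, by
    scalar products of [u] with [v]. *)
Lemma drift_step n : exists t a,
  [/\ enorm (t *: o n) <= err n, u n.+1 = u n + t *: o n + a *: v n &
      a = slant n - dot (u n) (v n)].
Proof.
have [t [a [t0 tL uE]]] := u_step n; exists t, a; split=> //.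
  rewrite enormZ ger0_norm//; apply: (le_trans (ler_wpM2l t0 (o_decay n))).
  by rewrite ler_wpM2r// mulr_ge0 ?exprn_ge0 ?enorm_ge0.
by rewrite /slant uE !dotE vv (dotC (o n)) vo; ring.
Qed.

Lemma shadow_collision n :
  shadow n - err n <= enorm (proj_orth (v n) (u n.+1)).
Proof.
have [t [a [te uE _]]] := drift_step n.
have -> : proj_orth (v n) (u n.+1) = proj_orth (v n) (u n) + t *: o n.
  rewrite /proj_orth uE !dotE vv (dotC (o n)) vo mulr0 addr0 mulr1 scalerDl.
  by apply/rowP => i; rewrite !mxE; ring.
have := ler_distB_enorm (proj_orth (v n) (u n)) (- (t *: o n)).
by rewrite opprK enormN /shadow; lra.
Qed.

(** Pythagoras for [u n.+1] with respect to [v n] and to [v n.+1]: the component along the velocity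
    passes from [slant n] to [r * slant n], and the lost square goes to the shadow. *)
Lemma shadow_reflection n :
  enorm (proj_orth (v n) (u n.+1)) ^+ 2 + (1 - kap ^+ 2) * slant n ^+ 2 <=
  shadow n.+1 ^+ 2.
Proof.
have [r [r0 rk rE]] := v_step n.
have := sqr_enorm_proj_orth n.+1 (u n.+1).
rewrite (sqr_enorm_proj_orth n) rE// -/(slant n) -/(shadow n.+1) => h.
have : r ^+ 2 * slant n ^+ 2 <= kap ^+ 2 * slant n ^+ 2.
  by rewrite ler_wpM2r ?sqr_ge0// ler_sqr.
rewrite exprMn in h; lra.
Qed.

Lemma one_sub_kap2 : 0 < 1 - kap ^+ 2.
Proof. by rewrite subr_gt0 exprn_ilt1. Qed.

Lemma shadow_reflection_le n :
  enorm (proj_orth (v n) (u n.+1)) <= shadow n.+1.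
Proof.
rewrite -ler_sqr ?nnegrE ?enorm_ge0//; apply: le_trans (shadow_reflection n).
by rewrite lerDl mulr_ge0 ?sqr_ge0// ltW// one_sub_kap2.
Qed.

(** [drift] decreases by [err n] at step [n], which is all that the shadow may lose there. *)
Lemma shadow_drift n m : (n <= m)%N -> shadow n - drift n <= shadow m - drift m.
Proof.
move=> /subnK <-; elim: (m - n)%N => [|k IH]; first by rewrite add0n.
apply: (le_trans IH); rewrite addSn (driftS (k + n)).
by have := le_trans (shadow_collision _) (shadow_reflection_le (k + n)); lra.
Qed.

(** The component of [u n.+1] along [v n.+1] is [r * slant n], so two consecutive slants bound the
    multiple of the velocity added by the flight. *)
Lemma u_variation n : enorm (u n.+2 - u n.+1) <=
  err n.+1 + `|slant n.+1| + `|slant n|.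
Proof.
have [t [a [te -> aE]]] := drift_step n.+1.
have -> : u n.+1 + t *: o n.+1 + a *: v n.+1 - u n.+1 =
    t *: o n.+1 + a *: v n.+1 by apply/rowP => i; rewrite !mxE; ring.
apply: le_trans (ler_enormD _ _) _.
rewrite -addrA lerD// enormZ.
have -> : enorm (v n.+1) = 1 by apply/eqP; rewrite enorm_eq1 vv.
have [r [r0 rk rE]] := v_step n.
rewrite mulr1 aE rE// -/(slant n); apply: le_trans (ler_normB _ _) _.
by rewrite lerD2l normrM ger0_norm// ler_piMl// (le_trans rk)// ltW.
Qed.

Context (k : nat) (C : R) (C0 : 0 <= C).
Context (span : forall n z m, 0 <= m ->
  (forall j, (j < k)%N -> `|dot (e (n + j)) z| <= m) -> enorm z <= C * m).

(* Otherwise every [slant] of the block is small compared with [shadow n], so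
   that [u] is almost constant along the block although it is orthogonal to
   each of the spanning vectors [e]. *)
Lemma shadow_growth : exists2 del : R, 0 < del & forall n,
  drift n <= del * shadow n -> (1 + del) * shadow n <= shadow (n + k.+1).
Proof.
(* With [q = 1 / B], the spanning bound will read [C * (1 + 2 * k) * q * A = A - 3 * q * A]; the
   summand 3 makes this smaller than the lower bound [(1 - 2 * del) * A]. *)
pose B : R := C * (1 + 2 * k%:R) + 3.
have kk : 0 <= k%:R :> R by [].
have B3 : 3 <= B by rewrite lerDr mulr_ge0// addr_ge0// mulr_ge0.
have B0 : 0 < B by lra.
pose q := B^-1.
have q0 : 0 < q by rewrite invr_gt0.
have q3 : q * 3 <= 1 by rewrite /q mulrC ler_pdivrMr// mul1r.
have sp := one_sub_kap2.
(* Chosen so that [8 * del], the difference of the squares of [1 + 2 * del] and [1 - 2 * del],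
   equals [(1 - kap ^+ 2) * q ^+ 2]; this forces every slant of the block below [q * A]. *)
pose del := q ^+ 2 * (1 - kap ^+ 2) / 8.
have del0 : 0 < del by rewrite divr_gt0// mulr_gt0// exprn_gt0.
have delq : del <= q / 8.
  rewrite /del ler_pM2r ?invr_gt0// expr2 -mulrA ler_piMr ?(ltW q0)//.
  rewrite mulr_ile1 ?(ltW q0) ?(ltW sp)//; first by lra.
  by rewrite lerBlDr lerDl sqr_ge0.
exists del => // n dn; rewrite leNgt; apply/negP => an.
set A := shadow n in dn an *.
have A0 : 0 < A.
  rewrite lt_def shadow_ge0 andbT; apply: contraTneq an => ->.
  by rewrite mulr0 -leNgt shadow_ge0.
have dA : del * A <= q / 8 * A by rewrite ler_pM2r.
have lo j : (n <= j)%N -> (1 - del) * A <= shadow j.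
  by move=> nj; have := shadow_drift nj; have := drift_ge0 j; rewrite -/A; lra.
(* Shadow minus drift never decreases, so the failure of growth at the end of the block bounds every
   shadow inside it. *)
have hi j : (j <= n + k.+1)%N -> (n <= j)%N -> shadow j <= (1 + 2 * del) * A.
  move=> jk nj; have := shadow_drift jk; have := drift_ge0 (n + k.+1).
  have := drift_le nj; lra.
have errd j : (n <= j)%N -> err j <= del * A.
  move=> nj; apply: le_trans dn; apply: le_trans (drift_le nj).
  by rewrite [leRHS]driftS lerDl drift_ge0.
have col j : (n <= j)%N ->
    (1 - 2 * del) * A <= enorm (proj_orth (v j) (u j.+1)).
  move=> nj; apply: le_trans (shadow_collision j).
  by have := lo _ nj; have := errd _ nj; lra.
have d1 : 0 <= 1 - 2 * del by lra.
have sl j : (n <= j)%N -> (j < n + k.+1)%N -> `|slant j| <= q * A.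
  move=> nj jk; rewrite -ler_sqr ?nnegrE ?mulr_ge0 ?(ltW q0) ?(ltW A0)//.
  rewrite real_normK ?num_real// -(ler_pM2l sp).
  have h1 : ((1 - 2 * del) * A) ^+ 2 <=
      enorm (proj_orth (v j) (u j.+1)) ^+ 2.
    by rewrite ler_sqr ?nnegrE ?enorm_ge0 ?col// mulr_ge0// ltW.
  have h2 : shadow j.+1 ^+ 2 <= ((1 + 2 * del) * A) ^+ 2.
    rewrite ler_sqr ?nnegrE ?shadow_ge0 ?hi// ?(leq_trans nj)//.
    by rewrite mulr_ge0 ?(ltW A0)//; lra.
  have := shadow_reflection j.
  have -> : (1 - kap ^+ 2) * (q * A) ^+ 2 =
      ((1 + 2 * del) * A) ^+ 2 - ((1 - 2 * del) * A) ^+ 2.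
    by rewrite /del; field.
  lra.
(* The reference vector is [u n.+1], not [u n], since [u_variation] only controls the increments
   that follow a collision. *)
have var j : (j < k)%N -> enorm (u (n + j).+1 - u n.+1) <=
    drift n - drift (n + j).+1 + 2 * j%:R * (q * A).
  elim: j => [_|j IH jk].
    rewrite addn0 subrr enorm0 mulr0 mul0r addr0 subr_ge0.
    exact: drift_le.
  rewrite addnS -(subrK (u (n + j).+1) (u _.+2)) -addrA.
  apply: le_trans (ler_enormD _ _) _.
  have := IH (ltnW jk); have := u_variation (n + j).
  have := sl (n + j)%N (leq_addr _ _).
  rewrite ltn_add2l => /(_ (leqW (ltnW jk))).
  have := sl (n + j).+1 (leq_trans (leq_addr _ _) (leqnSn _)).
  rewrite -addnS ltn_add2l => /(_ (leqW jk)).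
  have := driftS (n + j.+1); rewrite -[j.+1%:R]natr1.
  lra.
have uA : (1 - 2 * del) * A <= enorm (u n.+1).
  apply: le_trans (col n (leqnn n)) _.
  rewrite -ler_sqr ?nnegrE ?enorm_ge0// (sqr_enorm_proj_orth n (u n.+1)).
  by rewrite lerDl sqr_ge0.
have : enorm (u n.+1) <= C * (q * A + 2 * k%:R * (q * A)).
  apply: (span (n := n.+1)) => [|j jk].
    by rewrite addr_ge0 ?mulr_ge0// ltW.
  have -> : dot (e (n.+1 + j)) (u n.+1) =
      - dot (e (n + j).+1) (u (n + j).+1 - u n.+1).
    by rewrite dotBr eu addSn; ring.
  rewrite normrN; apply: le_trans (ler_dot_enorm _ _) _.
  have -> : enorm (e (n + j).+1) = 1 by apply/eqP; rewrite enorm_eq1 ee.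
  rewrite mul1r; apply: (le_trans (var j jk)); apply: lerD.
    by have := drift_ge0 (n + j).+1; have := mulr_gt0 q0 A0; lra.
  rewrite ler_wpM2r ?mulr_ge0 ?(ltW q0) ?(ltW A0)// ler_pM2l// ler_nat.
  exact: ltnW.
have : q * A * B = A by rewrite mulrAC /q mulVf ?mul1r// gt_eqF.
rewrite /B; have := mulr_gt0 q0 A0.
lra.
Qed.

Lemma cocycle_dichotomy :
  (exists m K (del a : R), [/\ (0 < K)%N, 0 < del, 0 < a &
     forall j, a * (1 + del) ^+ j <= enorm (u (m + j * K))]) \/
  (exists c : R, forall n, enorm (u n) <= c * kap ^+ n.-1).
Proof.
have [del del0 grow] := shadow_growth.
have shadow_le n : shadow n <= enorm (u n).
  rewrite -ler_sqr ?nnegrE ?enorm_ge0// (sqr_enorm_proj_orth n (u n)).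
  by rewrite lerDl sqr_ge0.
(* The condition persists from block to block: the drift decreases while the shadow grows. *)
have [[m [am dm]]|hN] := pselect (exists m, 0 < shadow m /\
    drift m <= del * shadow m).
  left; exists m, k.+1, del, (shadow m); split=> // j.
  apply: le_trans (shadow_le _).
  suff : shadow m * (1 + del) ^+ j <= shadow (m + j * k.+1) /\
      drift (m + j * k.+1) <= del * shadow (m + j * k.+1) by case.
  elim: j => [|j [IH1 IH2]]; first by rewrite expr0 mulr1 mul0n addn0.
  have h := grow _ IH2; rewrite -addnA -mulSnr in h.
  have s0 := shadow_ge0 (m + j * k.+1).
  have h' : shadow (m + j * k.+1) <= shadow (m + j.+1 * k.+1).
    by apply: le_trans h; rewrite ler_peMl// lerDl ltW.
  split.
    apply: le_trans h; rewrite exprS mulrCA ler_wpM2l//; lra.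
  apply: (le_trans (drift_le (_ : (m + j * k.+1 <= _)%N))).
    by rewrite leq_add2l leq_mul2r leqnSn orbT.
  by apply: (le_trans IH2); rewrite ler_pM2l.
right; have sp := one_sub_kap2.
have hs n : shadow n <= drift n / del.
  rewrite ler_pdivlMr// mulrC leNgt; apply/negP => h; apply: hN; exists n.
  rewrite ltW//; split=> //.
  by rewrite -(pmulr_rgt0 _ del0) (le_lt_trans (drift_ge0 n)).
(* [s] bounds the squared ratio of [enorm (u n.+1)] to [shadow n.+1], because [shadow_reflection]
   controls the slant by the shadow; as [1 <= s], it bounds the ratio itself. *)
pose s := 1 + (1 - kap ^+ 2)^-1.
have s1 : 1 <= s by rewrite lerDl invr_ge0 ltW.
(* The first summand serves [n = 0], which no collision precedes. *)
pose c := enorm (u 0%N) + s * (L * enorm (o 0%N) / (1 - kap) / del).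
have p0 : 0 <= s * (L * enorm (o 0%N) / (1 - kap) / del).
  rewrite mulr_ge0 ?(le_trans _ s1)//.
  rewrite !divr_ge0 ?mulr_ge0 ?enorm_ge0 ?(ltW del0)//.
  by rewrite subr_ge0 ltW.
exists c => -[|n]; first by rewrite expr0 mulr1 lerDl.
apply: (@le_trans _ _ (s * shadow n.+1)).
  rewrite -ler_sqr ?nnegrE ?enorm_ge0 ?mulr_ge0 ?shadow_ge0 ?(le_trans _ s1)//.
  rewrite (sqr_enorm_proj_orth n) -/(slant n) exprMn.
  have := shadow_reflection n; set x := enorm _ ^+ 2; set y := slant n ^+ 2.
  set z := shadow n.+1 ^+ 2 => h.
  have z0 : 0 <= z by rewrite sqr_ge0.
  have x0 : 0 <= x by rewrite sqr_ge0.
  have y0 : 0 <= y by rewrite sqr_ge0.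
  have y1 : y <= z * (1 - kap ^+ 2)^-1 by rewrite ler_pdivlMr// mulrC; lra.
  have x1 : x <= z by have := mulr_ge0 (ltW sp) y0; lra.
  have : x + y <= s * z by rewrite /s; lra.
  move=> /le_trans; apply; rewrite expr2 -mulrA ler_peMl// mulr_ge0//; lra.
apply: (@le_trans _ _ (s * (drift n.+1 / del))).
  by rewrite ler_wpM2l ?(le_trans _ s1).
have kn : 0 <= kap ^+ n by rewrite exprn_ge0.
have -> : s * (drift n.+1 / del) =
    s * (L * enorm (o 0%N) / (1 - kap) / del) * (kap * kap ^+ n).
  by rewrite /drift exprS; ring.
rewrite /c /= [leRHS]mulrDl -[leLHS]add0r; apply: lerD.
  by rewrite mulr_ge0 ?enorm_ge0.
by rewrite ler_wpM2l// ler_piMl// ltW.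
Qed.

End Cocycle.

(** * From growth and decay bounds to the sign of the exponent *)

Section Rates.
Context {R : realType}.
Implicit Types (t : nat -> R).

Definition rate t : \bar R :=
  limn_esup (fun n => (n%:R^-1)%:E * lne (t n)%:E)%E.

Lemma lee_lne_EFin (x y : R) : 0 <= x -> x <= y -> (lne x%:E <= lne y%:E)%E.
Proof.
move=> x0 xy; have mem (z : R) : 0 <= z -> z%:E \in `[0%E, +oo%E].
  by move=> z0; rewrite in_itv /= lee_fin z0 leey.
by rewrite lee_lne ?lee_fin// mem// (le_trans x0).
Qed.

Lemma exists_nat_ge (x : R) : exists n : nat, x <= n%:R.
Proof. by exists (Num.truncn x).+1; rewrite ltW// truncnS_gt. Qed.

(** An upper limit only needs growth along one arithmetic progression. The bound [b] is half of the
    rate [lam / K]; the other half absorbs [m] and [ln a] for large [j]. *)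
Lemma rate_gt0 t (m K : nat) (del a : R) : (0 < K)%N -> 0 < del -> 0 < a ->
  (forall j, a * (1 + del) ^+ j <= t (m + j * K)%N) -> (0 < rate t)%E.
Proof.
move=> K0 del0 a0 ht; have d1 : 0 < 1 + del by rewrite addr_gt0.
pose lam := ln (1 + del); have lam0 : 0 < lam by rewrite ln_gt0// ltrDl.
have K0' : 0 < K%:R :> R by rewrite ltr0n.
pose b := lam / (2 * K%:R); have b0 : 0 < b by rewrite divr_gt0// mulr_gt0.
apply: (@lt_le_trans _ _ b%:E); first by rewrite lte_fin.
apply: le_ereal_inf_tmp => _ [V [N _ NV] <-].
have [j jb jN] : exists2 j : nat, `|m%:R * b - ln a| * 2 / lam <= j%:R &
    (N < j)%N.
  have [J hJ] := exists_nat_ge (`|m%:R * b - ln a| * 2 / lam).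
  exists (maxn N.+1 J); last exact: leq_maxl.
  by rewrite (le_trans hJ)// ler_nat leq_maxr.
pose n := (m + j * K)%N.
have jn : (j <= n)%N by rewrite (leq_trans _ (leq_addl _ _))// leq_pmulr.
have n0 : (0 < n)%N by rewrite (leq_trans _ jn)// (leq_trans _ jN).
apply: le_trans (_ : ((n%:R^-1)%:E * lne (t n)%:E <= _)%E); last first.
  apply: ereal_sup_ubound; exists n => //; apply: NV => /=.
  exact: leq_trans (ltnW jN) jn.
have an0 : 0 < a * (1 + del) ^+ j by rewrite mulr_gt0// exprn_gt0.
apply: le_trans (lee_wpmul2l _ (lee_lne_EFin (ltW an0) (ht j))); last first.
  by rewrite lee_fin invr_ge0.
rewrite lne_EFin// -EFinM lee_fin lnM ?posrE ?exprn_gt0// lnXn// -/lam.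
rewrite ler_pdivlMl ?ltr0n// /n natrD natrM mulrDl.
have -> : j%:R * K%:R * b = j%:R * lam / 2.
  by rewrite /b; field; rewrite gt_eqF.
rewrite -[lam *+ j]mulr_natl.
have : `|m%:R * b - ln a| * 2 <= j%:R * lam by rewrite -ler_pdivrMr.
by have := ler_norm (m%:R * b - ln a); lra.
Qed.

(** Half of the decay rate absorbs the constant. Terms with [t n = 0] are covered by the
    monotonicity of [lne], which is [-oo] there. *)
Lemma rate_lt0 t (c kap : R) : 0 < kap -> kap < 1 ->
  (forall n, 0 <= t n <= c * kap ^+ n) -> (rate t < 0)%E.
Proof.
move=> k0 k1 ht; pose C := `|c| + 1; have C0 : 0 < C by rewrite ltr_wpDl.
pose lam := - ln kap.
have lam0 : 0 < lam by rewrite oppr_gt0 ln_lt0// k0.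
apply: (@le_lt_trans _ _ (- (lam / 2))%:E); last first.
  by rewrite lte_fin oppr_lt0 divr_gt0.
have [N N0 hN] : exists2 N : nat, (0 < N)%N & `|ln C| * 2 / lam <= N%:R.
  have [N hN] := exists_nat_ge (`|ln C| * 2 / lam).
  by exists N.+1; rewrite ?(le_trans hN)// ler_nat.
apply: ge_ereal_inf; exists (ereal_sup ((fun n => (n%:R^-1)%:E *
    lne (t n)%:E)%E @` [set n | (N <= n)%N])).
  by exists [set n | (N <= n)%N] => //; exists N.
apply: ge_ereal_sup => _ [n /= Nn <-].
have n0 : (0 < n)%N by exact: leq_trans Nn.
have Ck : 0 < C * kap ^+ n by rewrite mulr_gt0// exprn_gt0.
have /andP[t0 tc] := ht n.
have tC : t n <= C * kap ^+ n.
  apply: (le_trans tc); rewrite ler_wpM2r ?exprn_ge0 ?(ltW k0)//.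
  by rewrite (le_trans (ler_norm c))// lerDl.
apply: (le_trans (lee_wpmul2l _ (lee_lne_EFin t0 tC))).
  by rewrite lee_fin invr_ge0.
rewrite lne_EFin// -EFinM lee_fin lnM ?posrE ?exprn_gt0// lnXn//.
rewrite ler_pdivrMl ?ltr0n// -[ln kap *+ n]mulr_natl.
have Nb : `|ln C| * 2 / lam <= n%:R by rewrite (le_trans hN)// ler_nat.
rewrite ler_pdivrMr// in Nb.
have -> : ln kap = - lam by rewrite opprK.
by have := ler_norm (ln C); lra.
Qed.

End Rates.

(** * Measurability of the domain of the dynamics *)

Section Measurability.
Context {R : realType} {d : nat} (f : R -> R) (P : set 'rV[R]_d) (I : finType).
Context (eta : I -> 'rV[R]_d) (c : I -> R) (irrP : irredundant P eta c).
Context (cP : compact P) (hf : contracting_law f).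
Implicit Types (x : phase R d).

Lemma open_borel (A : set (phase R d)) :
  open A -> measurable (A : set (borel_phase R d)).
Proof. exact: sub_sigma_algebra. Qed.

Lemma closed_borel (A : set (phase R d)) :
  closed A -> measurable (A : set (borel_phase R d)).
Proof.
move=> cA; rewrite -[X in measurable X]setCK; apply: measurableC.
by apply: open_borel; exact: closed_openC.
Qed.

Lemma measurable_within_continuous (H : set (phase R d))
    (F : phase R d -> phase R d) (B : set (borel_phase R d)) :
  measurable (H : set (borel_phase R d)) ->
  (forall x, H x -> F y @[y --> within H (nbhs x)] --> F x) ->
  measurable B -> measurable (H `&` F @^-1` B : set (borel_phase R d)).
Proof.
move=> mH cF mB.
have mF : measurable_fun (H : set (borel_phase R d))
    (F : borel_phase R d -> borel_phase R d).
  apply: (@measurability _ _ (borel_phase R d) (borel_phase R d) H F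
    (@open (phase R d))) => //.
  move=> _ [U oU <-].
  (* Relative continuity makes the preimage the trace on [H] of an open set. *)
  have -> : H `&` F @^-1` U = H `&` [set y | H y -> U (F y)]°.
    apply/seteqP; split=> x [Hx].
      move=> Ux; split=> //; apply: (cF x Hx).
      exact: open_nbhs_nbhs.
    by move=> /interior_subset/(_ Hx).
  by apply: measurableI => //; apply: open_borel; exact: open_interior.
exact: mF.
Qed.

Lemma continuous_dot_fst (e : 'rV[R]_d) :
  continuous (fun x : phase R d => dot e x.1).
Proof. by move=> x; apply: cvg_dot; [exact: cvg_cst|exact: cvg_fst]. Qed.

Lemma continuous_dot_snd (e : 'rV[R]_d) :
  continuous (fun x : phase R d => dot e x.2).
Proof. by move=> x; apply: cvg_dot; [exact: cvg_cst|exact: cvg_snd]. Qed.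

Lemma measurable_on_wall i :
  measurable (on_wall eta c i : set (borel_phase R d)).
Proof.
have -> : on_wall eta c i =
    ([set x | dot (eta i) x.1 = c i] `&` [set x | enorm x.2 = 1]) `&`
    ([set x | forall l, l != i -> c l < dot (eta l) x.1] `&`
     [set x | 0 < dot (eta i) x.2]).
  apply/seteqP; split=> x; first by move=> [[]].
  by move=> [[? ?] []].
apply: measurableI; apply: measurableI.
- apply: closed_borel.
  apply: (preimage_closed (f := fun y => dot (eta i) y.1)) (@closed_eq _ (c i)).
  by move=> x _; exact: continuous_dot_fst.
- apply: closed_borel.
  apply: (preimage_closed (f := fun y => enorm y.2)) (@closed_eq _ 1).
  by move=> x _; apply: cvg_enorm; exact: cvg_snd.
- apply: open_borel; rewrite openE => x xl; rewrite /interior /=.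
  have h1 : y.1 @[y --> x] --> x.1 by exact: cvg_fst.
  exact: (near_on_facet (FF := nbhs_filter x) (A := fun l => l != i) h1 xl).
- apply: open_borel.
  apply: (open_comp (f := fun y => dot (eta i) y.2)) (@open_gt _ 0).
  by move=> x _; exact: continuous_dot_snd.
Qed.

Lemma measurable_hits j : measurable (hits eta c j : set (borel_phase R d)).
Proof.
apply: open_borel; rewrite openE => x xj; rewrite /interior /=.
exact: (near_hits (FF := nbhs_filter x) (h := id) _ xj).
Qed.

(** On wall points velocities have unit length, so the reflected ones lie in the half sphere, where
    the law is Lipschitz. *)
Lemma collide_within_continuous i j x :
  (on_wall eta c i `&` hits eta c j) x ->
  collide f eta c j y
    @[y --> within (on_wall eta c i `&` hits eta c j) (nbhs x)] -->
    collide f eta c j x.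
Proof.
move=> [[_ x1 _] xj]; have e1 := eta_unit irrP j.
have [kap [kap0 _ hsin hcos]] := law_contraction hf.
set H := _ `&` _.
have id : y @[y --> within H (nbhs x)] --> x by exact: cvg_within.
have id1 : y.1 @[y --> within H (nbhs x)] --> x.1.
  exact: (cvg_comp _ _ id (@cvg_fst _ _ _ _ _)).
have id2 : y.2 @[y --> within H (nbhs x)] --> x.2.
  exact: (cvg_comp _ _ id (@cvg_snd _ _ _ _ _)).
have q1 : y.1 + wall_time eta c j y *: y.2 @[y --> within H (nbhs x)] -->
    x.1 + wall_time eta c j x *: x.2.
  apply: cvgD => //; apply: cvgZ => //; apply: (cvg_wall_time id).
  by rewrite lt_eqF//; case: xj.
suff q2 : law_map f (eta j) (reflection (eta j) y.2)
    @[y --> within H (nbhs x)] --> law_map f (eta j) (reflection (eta j) x.2).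
  exact: cvg_pair q1 q2.
apply: (law_map_cvg hf e1 kap0 hsin hcos).
- rewrite near_withinE; apply: nearW => y [[_ y1 _] [yj _]].
  exact: reflection_half_sphere.
- by apply: reflection_half_sphere => //; case: xj.
- apply: cvgB => //; apply: cvgZr_tmp; apply: cvgM; first exact: cvg_cst.
  by apply: cvg_dot => //; exact: cvg_cst.
Qed.

Lemma M'E : M' P = \bigcup_i \bigcup_j (on_wall eta c i `&` hits eta c j).
Proof.
apply/seteqP; split=> x.
  move=> /(M'_hits irrP cP)[i [j [xi xj]]].
  by exists i => //; exists j.
by move=> [i _ [j _ [xi xj]]]; exact: (hits_M' irrP xi xj).
Qed.

Lemma measurable_M' : measurable (M' P : set (borel_phase R d)).
Proof.
rewrite M'E; apply: fin_bigcup_measurable => // i _.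
apply: fin_bigcup_measurable => // j _.
by apply: measurableI; [exact: measurable_on_wall|exact: measurable_hits].
Qed.

Lemma measurable_Phi_preimage (B : set (borel_phase R d)) : measurable B ->
  measurable (M' P `&` Phi f P @^-1` B : set (borel_phase R d)).
Proof.
move=> mB; have -> : M' P `&` Phi f P @^-1` B = \bigcup_i \bigcup_j
    ((on_wall eta c i `&` hits eta c j) `&` collide f eta c j @^-1` B).
  apply/seteqP; split=> x.
    move=> [/(M'_hits irrP cP)[i [j [xi xj]]] /=].
    by rewrite (Phi_collide f irrP xi xj) => xB; exists i => //; exists j.
  move=> [i _ [j _ [[xi xj] xB]]]; split; first exact: (hits_M' irrP xi xj).
  by rewrite /= (Phi_collide f irrP xi xj).
apply: fin_bigcup_measurable => // i _; apply: fin_bigcup_measurable => // j _.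
apply: measurable_within_continuous => //.
  by apply: measurableI; [exact: measurable_on_wall|exact: measurable_hits].
exact: collide_within_continuous.
Qed.

(** Gives [integrable_ae] its measurable domain. [E n] collects the points whose iterates of index 0
    to [n] lie in [M']. *)
Lemma measurable_Mplus : measurable (Mplus f P : set (borel_phase R d)).
Proof.
pose E n : set (phase R d) := iter n (fun B => M' P `&` Phi f P @^-1` B) (M' P).
have mE n : measurable (E n : set (borel_phase R d)).
  elim: n => [|n IH]; first exact: measurable_M'.
  exact: measurable_Phi_preimage.
have -> : Mplus f P = \bigcap_n E n.
  apply/seteqP; split=> x.
    move=> [_ xM] n _; elim: n x xM => [|n IH] x xM; first exact: (xM 0%N).
    split; first exact: (xM 0%N).
    by apply: IH => m; have := xM m.+1; rewrite iterSr.
  move=> xE; have h n y : E n y -> M' P (iter n (Phi f P) y).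
    by elim: n y => [//|n IH] y [_ /IH]; rewrite iterSr.
  split=> [|n]; last exact: h (xE n Logic.I).
  by have [] := xE 0%N Logic.I.
exact: bigcapT_measurable.
Qed.

End Measurability.

(** * Exponents at generating points do not vanish *)

Section Hyperbolicity.
Context {R : realType} {d : nat} (f : R -> R) (P : set 'rV[R]_d).
Context (hP : is_polytope P) (Pd : has_dim P d) (hf : contracting_law f).
Implicit Types (x w : phase R d).

Lemma lyapunov_neq0 k x w : Mplus f P x -> generating f P k x ->
  tangent P x w -> lyapunov f P x w != 0%E.
Proof.
move=> xM gk xw.
have [I [eta [c irrP]]] := polytope_irredundant hP Pd; have [cP _] := hP.
have [kap [kap0 kap1 hsin hcos]] := law_contraction hf.
have [L [L0 rec]] := tangent_recurrence irrP cP hf kap0 hsin hcos.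
have {}rec := rec x w xM xw.
pose v n := (iter n (Phi f P) x).2.
pose e n := normal_at P (iter n (Phi f P) x).1.
pose u n := (DPhi f P n x w).1; pose o n := (DPhi f P n x w).2.
have eI n : exists i, e n = eta i by have [] := rec n.
have [s es] := choice eI.
have ee n : dot (e n) (e n) = 1 by rewrite es (eta_unit irrP).
have eu n : dot (e n) (u n) = 0 by have [] := rec n.
have vv n : dot (v n) (v n) = 1 by have [] := rec n.
have vo n : dot (v n) (o n) = 0 by have [] := rec n.
have ustep n : exists t a,
    [/\ 0 <= t, t <= L & u n.+1 = u n + t *: o n + a *: v n].
  by have [_ _ _ _ []] := rec n.
have ostep n : enorm (o n.+1) <= kap * enorm (o n).
  by have [_ _ _ _ []] := rec n.
have vstep n : exists r, [/\ 0 <= r, r <= kap & forall z,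
    dot (e n.+1) z = 0 -> dot z (v n.+1) = r * dot z (v n)].
  by have [_ _ _ _ []] := rec n.
have [C [C0 hC]] := spanning_bound eta k.
have span n z m : 0 <= m ->
    (forall j, (j < k)%N -> `|dot (e (n + j)%N) z| <= m) -> enorm z <= C * m.
  move=> m0 hz; apply: (hC (fun j : 'I_k => s (n + j)%N)) => //.
    have := gk n; congr (row_full _); apply/matrixP => i j.
    by rewrite !mxE -es.
  by move=> j; rewrite -es hz.
have tu n : enorm (u n) <= tnorm (DPhi f P n x w).
  by apply: ler_wsqrtr; rewrite lerDl dot_ge0.
have tuo n : tnorm (DPhi f P n x w) <= enorm (u n) + enorm (o n).
  rewrite -ler_sqr ?nnegrE ?sqrtr_ge0 ?addr_ge0 ?enorm_ge0//.
  rewrite sqr_sqrtr ?addr_ge0 ?dot_ge0// sqrrD !sqr_enorm.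
  have : 0 <= enorm (u n) * enorm (o n) by rewrite mulr_ge0 ?enorm_ge0.
  by rewrite /u /o; lra.
have [[m [K [del [a [K0 del0 a0 grow]]]]]|[b decay]] :=
    cocycle_dichotomy kap0 kap1 L0 ee eu vv vo ustep ostep vstep C0 span.
  rewrite gt_eqF//; apply: (rate_gt0 K0 del0 a0) => j.
  exact: le_trans (grow j) (tu _).
(* Positive even if [kap = 0], as the logarithm in [rate_lt0] requires. *)
pose q := (1 + kap) / 2.
have q0 : 0 < q by rewrite /q; lra.
have q1 : q < 1 by rewrite /q; lra.
have kq : kap <= q by rewrite /q; lra.
rewrite lt_eqF//.
(* The division by [q] absorbs the exponent [n.-1], including at [n = 0], where [1 <= q^-1]. *)
apply: (@rate_lt0 _ _ (`|b| / q + enorm (o 0%N)) q) => // n.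
rewrite sqrtr_ge0/= (le_trans (tuo n))// mulrDl lerD//.
  apply: (le_trans (decay n)).
  apply: (@le_trans _ _ (`|b| * q ^+ n.-1)).
    apply: (le_trans (ler_wpM2r (exprn_ge0 _ kap0) (ler_norm b))).
    by rewrite ler_wpM2l// lerXn2r ?nnegrE// ltW.
  rewrite -mulrA ler_wpM2l//; case: n => [|n] /=.
    by rewrite mulr1 invf_ge1// ltW.
  by rewrite exprS mulKf// gt_eqF.
apply: (le_trans (o_decay kap0 ostep n)); rewrite mulrC ler_wpM2l ?enorm_ge0//.
by rewrite lerXn2r ?nnegrE// ltW.
Qed.

Lemma escaping_time_fin_num x : escaping_time f P x \is a fin_num ->
  exists k, generating f P k x.
Proof.
move=> Tfin; apply: contrapT => hN; move: Tfin.
suff -> : escaping_time f P x = +oo%E by [].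
rewrite /escaping_time (_ : [set _ | _ in _] = set0) ?ereal_inf0//.
by apply/seteqP; split=> // y [k gk _]; apply: hN; exists k.
Qed.

End Hyperbolicity.

Theorem theorem2p11 (R : realType) (d : nat) (hd : (2 <= d)%N)
  (P : set 'rV[R]_d) (hP : is_polytope P) (hdim : has_dim P d)
  (hspan : spanning P)
  (f : R -> R) (hf : contracting_law f)
  (hinv : invertible_on_D f P)
  (mu : probability (borel_phase R d) R)
  (hsupp : supported_on_D f P mu)
  (hmu : Phi_invariant f P mu)
  (herg : Phi_ergodic f P mu)
  (hT : mu.-integrable (Mplus f P) (escaping_time f P)) :
  hyperbolic f P mu.
Proof.
have [I [eta [c irrP]]] := polytope_irredundant hP hdim; have [cP _] := hP.
have mM := measurable_Mplus irrP cP hf.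
(* Integrability makes the escaping time finite almost everywhere on [Mplus], and the term of index
   0 in the intersection [D] is [Mplus] itself. *)
have := integrable_ae mM hT; apply: filterS => x Tx Dx w xw _.
have [x0 x0M xx] := Dx 0%N Logic.I.
have xM : Mplus f P x by rewrite -xx.
have [k gk] := escaping_time_fin_num (Tx xM).
exact: (lyapunov_neq0 hP hdim hf xM gk xw).
Qed.
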